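(* Let $A,B\in\mathcal{S}_n$, $X\in\mathcal{M}_n$ and $r\ge 0$, and let $|||\cdot|||$ be a unitarily invariant norm on $\mathcal{M}_n$. Then \begin{align*} 2\,|||\,|A^{1/2}XB^{1/2}|^r\,|||^2 &\le \frac{1}{1-2\alpha}\int_\alpha^{1-\alpha} |||\,|A^{s}XB^{1/2}|^r\,|||\;|||\,|A^{1-s}XB^{1/2}|^r\,|||\,ds\\ &\quad+\frac{1}{1-2\beta}\int_\beta^{1-\beta} |||\,|A^{1/2}XB^{1-t}|^r\,|||\;|||\,|A^{1/2}XB^{t}|^r\,|||\,dt\\ &\le \frac{2}{(1-2\alpha)(1-2\beta)}\int_\alpha^{1-\alpha}\int_\beta^{1-\beta} |||\,|A^{s}XB^{1-t}|^r\,|||\;|||\,|A^{1-s}XB^{t}|^r\,|||\,dt\,ds\\ &\le |||\,|A^{\alpha}XB^{1-\beta}|^r\,|||\;|||\,|A^{1-\alpha}XB^{\beta}|^r\,|||+|||\,|A^{1-\alpha}XB^{1-\beta}|^r\,|||\;|||\,|A^{\alpha}XB^{\beta}|^r\,||| \end{align*} for all $\alpha,\beta\in[0,\tfrac12)$, and \begin{align*} 2\,|||\,|A^{1/2}XB^{1/2}|^r\,|||^2 &\le \frac{1}{2\alpha-1}\int_{1-\alpha}^{\alpha} |||\,|A^{s}XB^{1/2}|^r\,|||\;|||\,|A^{1-s}XB^{1/2}|^r\,|||\,ds\\ &\quad+\frac{1}{2\beta-1}\int_{1-\beta}^{\beta} |||\,|A^{1/2}XB^{1-t}|^r\,|||\;|||\,|A^{1/2}XB^{t}|^r\,|||\,dt\\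 &\le \frac{2}{(2\alpha-1)(2\beta-1)}\int_{1-\alpha}^{\alpha}\int_{1-\beta}^{\beta} |||\,|A^{s}XB^{1-t}|^r\,|||\;|||\,|A^{1-s}XB^{t}|^r\,|||\,dt\,ds\\ &\le |||\,|A^{\alpha}XB^{1-\beta}|^r\,|||\;|||\,|A^{1-\alpha}XB^{\beta}|^r\,|||+|||\,|A^{1-\alpha}XB^{1-\beta}|^r\,|||\;|||\,|A^{\alpha}XB^{\beta}|^r\,||| \end{align*} for all $\alpha,\beta\in(\tfrac12,1]$.
   Context: $\mathcal{M}_n$ is the algebra of $n\times n$ complex matrices, and $\mathcal{S}_n\subset\mathcal{M}_n$ is the set of positive semidefinite matrices. For $T\in\mathcal{M}_n$, $|T|=(T^*T)^{1/2}$. Nonnegative real powers of positive semidefinite matrices are taken by functional calculus, with the zeroth power equal to the identity matrix. A norm $|||\cdot|||$ on $\mathcal{M}_n$ is unitarily invariant if $|||UTV|||=|||T|||$ for all $T\in\mathcal{M}_n$ and all unitary $U,V\in\mathcal{M}_n$. *)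

(* Defs.v *)
From HB Require Import structures.
From mathcomp Require Import all_boot all_order all_algebra.
From mathcomp Require Import all_classical all_reals all_analysis.
From mathcomp Require Import complex.
Set Implicit Arguments.
Unset Strict Implicit.
Unset Printing Implicit Defensive.
Import Order.TTheory GRing.Theory Num.Theory.
Local Open Scope ring_scope.
Local Open Scope complex_scope.
Local Open Scope sesquilinear_scope.

(* In the partial order of R[i], [0 <= z] means that z is real and
   nonnegative. *)
Definition psdmx (R : realType) (n : nat) (A : 'M[R[i]]_n) : Prop :=
  A \is hermsymmx /\ forall x : 'cV[R[i]]_n, 0 <= (x^t* *m A *m x) 0 0.

(* Functional calculus for a hermitian matrix: its eigenvalues are real, so
   the real part loses nothing; for a non-normal A the value is irrelevant. *)
Definition mxfun (R : realType) (n : nat) (f : R -> R) (A : 'M[R[i]]_n) :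
    'M[R[i]]_n :=
  invmx (spectralmx A)
    *m diag_mx (map_mx (fun z => (f (complex.Re z))%:C) (spectral_diag A))
    *m spectralmx A.

(* Since [0 `^ 0 = 1], the zeroth power is the identity matrix, also for a
   singular A; [0 `^ s = 0] for [s != 0]. *)
Definition mxpow (R : realType) (n : nat) (A : 'M[R[i]]_n) (s : R) :
    'M[R[i]]_n :=
  mxfun (fun x => x `^ s) A.

Notation "A `^mx s" := (mxpow A s)
  (at level 29, left associativity, format "A  `^mx  s") : ring_scope.

Definition mxabs (R : realType) (n : nat) (T : 'M[R[i]]_n) : 'M[R[i]]_n :=
  (T^t* *m T) `^mx (1 / 2).

Definition is_mxnorm (R : realType) (n : nat) (N : 'M[R[i]]_n -> R) : Prop :=
  [/\ forall T, 0 <= N T,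
      forall T, N T = 0 -> T = 0,
      forall (c : R[i]) T, N (c *: T) = complex.Re `|c| * N T
    & forall S T, N (S + T) <= N S + N T].

Definition unitarily_invariant (R : realType) (n : nat)
    (N : 'M[R[i]]_n -> R) : Prop :=
  forall U T V : 'M[R[i]]_n,
    U \is unitarymx -> V \is unitarymx -> N (U *m T *m V) = N T.

(* ||| |T|^r ||| *)
Definition normabs (R : realType) (n : nat) (N : 'M[R[i]]_n -> R) (r : R)
    (T : 'M[R[i]]_n) : R :=
  N (mxabs T `^mx r).

(* Main.v *)
Require Import Defs.
From HB Require Import structures.
From mathcomp Require Import all_boot all_order all_algebra.
From mathcomp Require Import all_classical all_reals all_analysis.
From mathcomp Require Import fingroup perm complex measurable_realfun.
From mathcomp Require Import ring lra.
Set Implicit Arguments.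
Unset Strict Implicit.
Unset Printing Implicit Defensive.
Import Order.TTheory GRing.Theory Num.Theory numFieldNormedType.Exports.
Local Open Scope classical_set_scope.
Local Open Scope ring_scope.
Local Open Scope complex_scope.
Local Open Scope sesquilinear_scope.


(** Write [phi s u] for the norm of the [r]-th power of the modulus of
    [A^s X B^u].  The heart of the matter is that [phi] is midpoint
    log-convex in each variable separately on the unit square:
    [phi ((s + s') / 2) u ^+ 2 <= phi s u * phi s' u], and likewise in [u].
    Granting this, [F s t = phi s (1 - t) * phi (1 - s) t] is midpoint convex in
    [s] and in [t], and it is invariant under [(s, t) |-> (1 - s, 1 - t)].  It is
    also bounded, so it is separately convex, and the three inequalities are
    Hermite-Hadamard inequalities on intervals centred at [1 / 2]: the first is
    the lower bound on the two central lines; the second is the lower bound for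
    [F s] and for the function [s |-> \int F s t dt], which is again midpoint
    convex and bounded; the third is the upper bound used in both variables,
    where the symmetry merges the four corner values into two
    ([hermite_hadamard_square]).  Exponents in the interval from [1 / 2] to [1]
    give the same integrals after replacing [a, b] by [1 - a, 1 - b].

    Log-convexity is a statement on matrices.  Let [s <= s'] and let [E] be the
    power of [A] with exponent [(s' - s) / 2].  The three matrices
    involved are [S], [T = E S] and [T' = E T], with [E] hermitian, so that
    [T* T = S* T'].  It is therefore enough to show that [T* T = P* Q] implies
    that the square of the norm of [|T|^r] is at most the product of those of
    [|P|^r] and [|Q|^r] ([normabs_gram_le]).  Exponents of [B] follow by
    taking adjoints ([normabs_adj]).

    With eigenvalues listed in decreasing order, let [W] be the frame of the
    first [k] eigenvectors of [T* T].  The product of the first [k] eigenvalues of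
    [T* T] is the determinant of [(P W)* (Q W)].  By the Cauchy-Binet formula such
    determinants satisfy the Cauchy-Schwarz inequality ([gram_cauchy_schwarz]),
    and the determinant of [W* (P* P) W] is at most the product of the first [k]
    eigenvalues of [P* P] ([det_compress_le]).  So the eigenvalues of [T* T] are
    weakly log-majorized by the geometric means of those of [P* P] and
    [Q* Q], and this persists for all nonnegative powers.

    A unitarily invariant norm depends on a matrix only through the gauge
    [v |-> N (diag v)] of its singular values.  This gauge is symmetric,
    convex and monotone, hence monotone for weak log-majorization
    ([gauge_log_majorized]), and it satisfies a Cauchy-Schwarz inequality
    ([gauge_cauchy_schwarz]).  These two facts finish the argument. *)

(** * Adjoints, unitary matrices and real diagonal matrices *)

Lemma adjK (R : realType) (m n : nat) (M : 'M[R[i]]_(m, n)) : (M^t*)^t* = M.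
Proof. exact: trmxCK. Qed.

Lemma adj_mul (R : realType) (m n p : nat) (M : 'M[R[i]]_(m, n)) (M' : 'M[R[i]]_(n, p)) :
  (M *m M')^t* = M'^t* *m M^t*.
Proof. by rewrite trmx_mul map_mxM. Qed.

Lemma det_adj (R : realType) (k : nat) (M : 'M[R[i]]_k) : \det (M^t*) = (\det M)^*.
Proof. by rewrite det_map_mx det_tr. Qed.

Lemma colsub_adj (R : realType) (k n : nat) (M : 'M[R[i]]_(n, k)) (f : 'I_k -> 'I_n) :
  colsub f (M^t*) = (rowsub f M)^t*.
Proof. by apply/matrixP => i j; rewrite !mxE. Qed.

Lemma unitary_mulV (R : realType) (n : nat) (U : 'M[R[i]]_n) :
  U \is unitarymx -> U *m U^t* = 1%:M.
Proof. by move/unitarymxP. Qed.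

Lemma unitary_mulVl (R : realType) (n : nat) (U : 'M[R[i]]_n) :
  U \is unitarymx -> U^t* *m U = 1%:M.
Proof. by rewrite -trmxC_unitary => /unitarymxP; rewrite adjK. Qed.

Lemma unitarymx1 (R : realType) (n : nat) : (1%:M : 'M[R[i]]_n) \is unitarymx.
Proof. by apply/unitarymxP; rewrite trmx1 map_mx1 mul1mx. Qed.

Lemma perm_mx_unitary (R : realType) (n : nat) (s : 'S_n) :
  (perm_mx s : 'M[R[i]]_n) \is unitarymx.
Proof.
apply/unitarymxP; rewrite tr_perm_mx map_perm_mx -perm_mxM mulgV perm_mx1 //.
Qed.

Definition diagC (R : realType) (n : nat) (v : 'I_n -> R) : 'M[R[i]]_n :=
  diag_mx (\row_i (v i)%:C).

Lemma diagC_mul (R : realType) (n : nat) (u v : 'I_n -> R) :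
  diagC u *m diagC v = diagC (fun i => u i * v i).
Proof.
rewrite /diagC mulmx_diag; congr diag_mx; apply/rowP => i.
by rewrite !mxE rmorphM.
Qed.

Lemma diagC_adj (R : realType) (n : nat) (v : 'I_n -> R) : (diagC v)^t* = diagC v.
Proof.
rewrite /diagC tr_diag_mx map_diag_mx; congr diag_mx; apply/rowP => i.
by rewrite !mxE; apply: conj_Creal; apply/complex_realP; exists (v i).
Qed.

Lemma diagC_perm (R : realType) (n : nat) (s : 'S_n) (d : 'I_n -> R) :
  diagC d = (perm_mx s)^t* *m diagC (fun i => d (s i)) *m perm_mx s.
Proof.
have -> : diagC (fun i => d (s i)) = perm_mx s *m diagC d *m (perm_mx s)^t*.
  rewrite tr_perm_mx map_perm_mx -row_permE -col_permE.
  by apply/matrixP => i j; rewrite !mxE (inj_eq perm_inj).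
have pu := perm_mx_unitary R s.
by rewrite !mulmxA unitary_mulVl// mul1mx -mulmxA unitary_mulVl// mulmx1.
Qed.

Lemma det_diagC (R : realType) (n : nat) (d : 'I_n -> R) : \det (diagC d) = (\prod_i d i)%:C.
Proof. by rewrite det_diag rmorph_prod; apply: eq_bigr => i _; rewrite mxE. Qed.

(** * The gauge of a unitarily invariant norm *)

(** The symmetric gauge function of [N]: the norm as a function of the singular
    values. *)
Definition gauge (R : realType) (n : nat) (N : 'M[R[i]]_n -> R) (v : 'I_n -> R) : R :=
  N (diagC v).

Lemma norm_real_scale (R : realType) (n : nat) (N : 'M[R[i]]_n -> R) (c : R) T :
  is_mxnorm N -> 0 <= c -> N (c%:C *: T) = c * N T.
Proof.
case=> _ _ NZ _ c0; rewrite NZ; congr (_ * _).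
by rewrite ger0_norm ?lecR.
Qed.

Lemma gauge_perm (R : realType) (n : nat) (N : 'M[R[i]]_n -> R) (s : 'S_n) v :
  unitarily_invariant N -> gauge N (fun i => v (s i)) = gauge N v.
Proof.
move=> NUI; rewrite /gauge -(NUI (perm_mx s) (diagC v) (perm_mx s^-1)%g) ?perm_mx_unitary//.
congr N; rewrite -row_permE -col_permE; apply/matrixP => i j.
by rewrite !mxE (inj_eq perm_inj).
Qed.

Lemma gauge_convex (R : realType) (n : nat) (N : 'M[R[i]]_n -> R) (a b : R) u v :
  is_mxnorm N -> 0 <= a -> 0 <= b ->
  gauge N (fun i => a * u i + b * v i) <= a * gauge N u + b * gauge N v.
Proof.
move=> hN a0 b0; rewrite /gauge -!norm_real_scale//.
have [_ _ _ ND] := hN; apply: le_trans (ND _ _).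
rewrite le_eqVlt; apply/orP; left; apply/eqP; congr N.
apply/matrixP => i j; rewrite !mxE rmorphD !rmorphM /=.
by case: eqP => _; rewrite ?mulr1n ?mulr0n ?mulr0 ?addr0.
Qed.

(** If [0 <= u i <= v i], write [u i] as [v i] times the cosine of an angle.
    Then [diag u] is the mean of [E *m diag v] and [E^t* *m diag v] for the
    diagonal unitary matrix [E] of these angles, so no coordinatewise
    induction is needed. *)
Lemma gauge_le (R : realType) (n : nat) (N : 'M[R[i]]_n -> R) u v :
  is_mxnorm N -> unitarily_invariant N ->
  (forall i, 0 <= u i <= v i) -> gauge N u <= gauge N v.
Proof.
move=> hN NUI uv.
(* [e i] has modulus 1 and real part [u i / v i]; the junk value [u i / 0 = 0]
   is harmless because [v i = 0] forces [u i = 0]. *)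
pose t i := u i / v i.
have t01 i : 0 <= t i <= 1.
  have /andP[u0 uvi] := uv i; have v0 := le_trans u0 uvi.
  rewrite /t divr_ge0//=; have [->|vn0] := eqVneq (v i) 0.
    by rewrite invr0 mulr0.
  by rewrite ler_pdivrMr ?mul1r// lt_neqAle eq_sym vn0.
pose e i : R[i] := (t i +i* Num.sqrt (1 - t i ^+ 2))%C.
have ee i : e i * (e i)^* = 1.
  have /andP[t0 t1] := t01 i; have s0 : 0 <= 1 - t i ^+ 2 by nra.
  rewrite /e; simpc; apply/eqP; rewrite eq_complex /= -(expr2 (Num.sqrt _)) sqr_sqrtr//.
  by apply/andP; split; apply/eqP; ring.
pose E : 'M[R[i]]_n := diag_mx (\row_i e i).
have EU : E \is unitarymx.
  apply/unitarymxP; rewrite /E tr_diag_mx map_diag_mx mulmx_diag -diag_const_mx.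
  by congr diag_mx; apply/rowP => i; rewrite !mxE; exact: ee.
have -> : gauge N u = N ((1 / 2 : R)%:C *: (E *m diagC v + E^t* *m diagC v)).
  congr N; rewrite -mulmxDl /E tr_diag_mx map_diag_mx -raddfD mulmx_diag /diagC.
  apply/matrixP => i j; rewrite !mxE; case: eqP => _; last by rewrite !mulr0n mulr0.
  rewrite !mulr1n.
  have -> : e i + (e i)^* = (2 * t i)%:C.
    by rewrite /e; simpc; apply/eqP; rewrite eq_complex /= eqxx andbT; apply/eqP; ring.
  rewrite -!rmorphM; congr (_%:C); rewrite /t.
  have [v0|vn0] := eqVneq (v i) 0; last by field.
  have /andP[u0 ] := uv i; rewrite v0 => u0'.
  have -> : u i = 0 by apply/eqP; rewrite eq_le u0 u0'.
  by ring.
rewrite norm_real_scale//.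
have [_ _ _ ND] := hN; have := ND (E *m diagC v) (E^t* *m diagC v).
have -> : N (E *m diagC v) = gauge N v.
  rewrite -[E *m _]mulmx1; exact: NUI EU (unitarymx1 R n).
have EU' : E^t* \is unitarymx by rewrite trmxC_unitary.
have -> : N (E^t* *m diagC v) = gauge N v.
  rewrite -[_ *m _]mulmx1; exact: NUI EU' (unitarymx1 R n).
lra.
Qed.

(** The arithmetic-geometric mean inequality with a free weight [a] bounds the
    left-hand gauge by [a / 2 * gauge N y + a^-1 / 2 * gauge N z]; optimizing
    over [a] gives the claim. *)
Lemma gauge_cauchy_schwarz (R : realType) (n : nat) (N : 'M[R[i]]_n -> R) (y z : 'I_n -> R) :
  is_mxnorm N -> unitarily_invariant N ->
  (forall i, 0 <= y i) -> (forall i, 0 <= z i) ->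
  gauge N (fun i => Num.sqrt (y i) * Num.sqrt (z i)) ^+ 2 <= gauge N y * gauge N z.
Proof.
move=> hN NUI y0 z0.
set g := gauge N _.
have ge0 v : 0 <= gauge N v by case: hN => + _ _ _; apply.
have amgm (a : R) : 0 < a -> g <= a / 2 * gauge N y + a^-1 / 2 * gauge N z.
  move=> a0; apply: le_trans (gauge_convex _ _ hN _ _); last 2 first.
  - by rewrite divr_ge0// ltW.
  - by rewrite divr_ge0// invr_ge0 ltW.
  apply: gauge_le => // i; rewrite mulr_ge0 ?sqrtr_ge0//=.
  rewrite -{2}(sqr_sqrtr (y0 i)) -{2}(sqr_sqrtr (z0 i)).
  set u := Num.sqrt _; set v := Num.sqrt _.
  rewrite -subr_ge0.
  have -> : a / 2 * u ^+ 2 + a^-1 / 2 * v ^+ 2 - u * v = a^-1 / 2 * (a * u - v) ^+ 2.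
    by field; rewrite gt_eqF.
  by rewrite mulr_ge0 ?sqr_ge0// divr_ge0// invr_ge0 ltW.
have g0 : 0 <= g by exact: ge0.
move: (gauge N y) (gauge N z) (ge0 y) (ge0 z) amgm => Y Z Y0 Z0 amgm.
have [Yz|Yn] := eqVneq Y 0.
  have [->|gn] := eqVneq g 0; first by rewrite expr0n mulr_ge0.
  have gp : 0 < g by rewrite lt_neqAle eq_sym gn.
  (* A large weight makes the bound on [g] smaller than [g] itself. *)
  have ap : 0 < (Z + 1) / g by rewrite divr_gt0// ltr_wpDl.
  have := amgm _ ap; rewrite Yz mulr0 add0r invf_div.
  have -> : g / (Z + 1) / 2 * Z = g * (Z / (Z + 1) / 2) by ring.
  rewrite -ler_pdivrMl// mulVf// ler_pdivlMr// ler_pdivlMr ?ltr_wpDl//; lra.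
have Yp : 0 < Y by rewrite lt_neqAle eq_sym Yn.
have [gz|gn] := eqVneq g 0; first by rewrite gz expr0n mulr_ge0.
have gp : 0 < g by rewrite lt_neqAle eq_sym gn.
(* With the weight [g / Y] the bound becomes [g <= (g ^+ 2 + Y * Z) / (2 * g)]. *)
have := amgm _ (divr_gt0 gp Yp).
have -> : g / Y / 2 * Y + (g / Y)^-1 / 2 * Z = (g ^+ 2 + Y * Z) / (2 * g).
  by field; rewrite !gt_eqF.
rewrite ler_pdivlMr ?mulr_gt0//; nra.
Qed.

(** * Weak log-majorization *)

Definition decreasing (R : realType) (n : nat) (d : 'I_n -> R) :=
  forall i j : 'I_n, (i <= j)%N -> d j <= d i.

(** Bringing two coordinates closer together without increasing their sum
    lowers the gauge: up to monotonicity, the new vector is a mixture of [q] and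
    of [q] with the two coordinates exchanged. *)
Lemma gauge_transfer (R : realType) (n : nat) (N : 'M[R[i]]_n -> R)
    (q q' : 'I_n -> R) (i j : 'I_n) :
  is_mxnorm N -> unitarily_invariant N -> i != j ->
  (forall l, 0 <= q' l) -> (forall l, l != i -> l != j -> q' l = q l) ->
  q j < q i -> q j <= q' i <= q i -> q' i + q' j <= q i + q j ->
  gauge N q' <= gauge N q.
Proof.
move=> hN NUI ij q'0 q'q ji /andP[jq' q'i] sum_le.
(* With this weight the mixture of [q] and its transposed copy has coordinate
   [i] equal to [q' i], and coordinate [j] equal to [q i + q j - q' i]. *)
pose a := (q' i - q j) / (q i - q j).
have d0 : 0 < q i - q j by rewrite subr_gt0.
have a0 : 0 <= a by rewrite /a divr_ge0 ?subr_ge0 // ltW.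
have b0 : 0 <= 1 - a by rewrite subr_ge0 /a ler_pdivrMr// mul1r lerD2r.
have aE : a * (q i - q j) = q' i - q j by rewrite /a divfK// gt_eqF.
have -> : gauge N q = a * gauge N q + (1 - a) * gauge N (fun l => q (tperm i j l)).
  by rewrite gauge_perm//; ring.
apply: le_trans (gauge_convex _ _ hN a0 b0); apply: gauge_le => // l.
rewrite q'0 /=; have [->|li] := eqVneq l i; first by rewrite tpermL; lra.
have [->|lj] := eqVneq l j; first by rewrite tpermR; lra.
by rewrite tpermD 1?eq_sym// q'q//; lra.
Qed.

(** Monotonicity of the gauge under weak log-majorization.  By induction on the
    number of coordinates where [p] and [q] differ: as long as [p] exceeds [q]
    somewhere, a factor [t] is moved from an earlier coordinate of [q] to that
    one.  Such a multiplicative transfer keeps the product and lowers the sum, so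
    [gauge_transfer] applies.  Working with products throughout avoids the
    passage through additive majorization, and also any logarithm of
    zero. *)
Lemma gauge_log_majorized (R : realType) (n : nat) (N : 'M[R[i]]_n -> R) (p q : 'I_n -> R) :
  is_mxnorm N -> unitarily_invariant N ->
  (forall i, 0 <= p i) -> (forall i, 0 <= q i) ->
  decreasing p ->
  (forall k : 'I_n, \prod_(i < n | (i <= k)%N) p i <= \prod_(i < n | (i <= k)%N) q i) ->
  gauge N p <= gauge N q.
Proof.
move=> hN NUI p0 + pdecr.
(* Only [p] is kept sorted: the transfers below need not preserve the order
   of [q]. *)
have [m] := ubnP #|[pred l | p l != q l]|.
elim: m => // m IH in q *; rewrite ltnS => card_le q0 pq.
have [/forallP le_pq|] := boolP [forall l, p l <= q l].
  by apply: gauge_le => // l; rewrite p0 le_pq.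
rewrite negb_forall => /existsP[j0]; rewrite -ltNge => j0P.
case: (@arg_minnP _ j0 (fun l => q l < p l) (fun l => l : nat) j0P) => j qpj jmin.
(* [j] is the first coordinate where [p] exceeds [q]; the prefix products up to
   [j] force a strict excess of [q] over [p] at some earlier [i]. *)
have before (l : 'I_n) : (l < j)%N -> p l <= q l.
  by move=> lj; rewrite leNgt; apply/negP => /jmin; rewrite leqNgt lj.
have pj0 : 0 < p j by exact: le_lt_trans qpj.
have ppos (l : 'I_n) : (l <= j)%N -> 0 < p l by move=> lj; exact: lt_le_trans (pdecr _ _ lj).
have prodj (f : 'I_n -> R) :
    \prod_(l < n | (l <= j)%N) f l = f j * \prod_(l < n | (l < j)%N) f l.
  rewrite (bigD1 j)//=; congr (_ * _); apply: eq_bigl => l.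
  by rewrite ltn_neqAle andbC.
have pprod0 : 0 < \prod_(l < n | (l < j)%N) p l by apply: prodr_gt0 => l /ltnW /ppos.
have qj0 : 0 < q j.
  rewrite lt_neqAle q0 andbT eq_sym; apply/eqP => qj; have := pq j.
  by rewrite !prodj qj mul0r leNgt mulr_gt0.
have [i ij piqi] : exists2 i : 'I_n, (i < j)%N & p i < q i.
  apply/exists_inP; apply: contraT; rewrite negb_exists => /forallP H.
  have := pq j; rewrite !prodj.
  rewrite [X in _ <= _ * X](eq_bigr p) => [|l lj]; last first.
    by apply/eqP; rewrite eq_le before// andbT leNgt; have := H l; rewrite lj.
  by rewrite ler_pM2r// leNgt qpj.
have neij : i != j by apply: contraTneq ij => ->; rewrite ltnn.
have pi0 : 0 < p i by exact/ppos/ltnW.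
have pji : p j <= p i by exact/pdecr/ltnW.
have qi0 : 0 < q i by exact: lt_trans piqi.
(* The largest factor that can be moved from [i] to [j] without overshooting;
   it makes [q] agree with [p] at [i] or at [j]. *)
pose t := Num.min (q i / p i) (p j / q j).
have t1 : 1 <= t by rewrite /t le_min !ler_pdivlMr// !mul1r !ltW.
have t0 : 0 < t by exact: lt_le_trans t1.
have tqi : p i <= q i / t.
  by rewrite ler_pdivlMr// mulrC -ler_pdivlMr// /t ge_min lexx.
have tqj : q j * t <= p j.
  by rewrite mulrC -ler_pdivlMr// /t ge_min lexx orbT.
pose q' l := if l == i then q i / t else if l == j then q j * t else q l.
have q'i : q' i = q i / t by rewrite /q' eqxx.
have q'j : q' j = q j * t by rewrite /q' eq_sym (negbTE neij) eqxx.
have q'l l : l != i -> l != j -> q' l = q l by rewrite /q' => /negbTE-> /negbTE->.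
have q'0 l : 0 <= q' l.
  rewrite /q'; case: eqP => _; first by rewrite divr_ge0 ?ltW.
  by case: eqP => _ //; rewrite mulr_ge0 ?ltW.
have ut : q i / t <= q i by rewrite ler_pdivrMr// ler_peMr// ltW.
apply: (@le_trans _ _ (gauge N q')).
  apply: IH => //.
    apply: leq_trans card_le; apply: proper_card; apply/properP; split.
      apply/fintype.subsetP => l; rewrite !inE; apply: contraNneq => pql.
      have li : l != i by apply: contraTneq piqi => <-; rewrite pql ltxx.
      have lj : l != j by apply: contraTneq qpj => <-; rewrite pql ltxx.
      by rewrite q'l ?pql.
    have [tE|tE] : t = q i / p i \/ t = p j / q j by rewrite /t; case: leP; auto.
      exists i; rewrite !inE ?(lt_eqF piqi)// q'i tE negbK; apply/eqP.
      by field; rewrite !gt_eqF.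
    exists j; rewrite !inE ?(gt_eqF qpj)// q'j tE negbK; apply/eqP.
    by field; rewrite gt_eqF.
  (* Prefix products change only for [i <= k < j], and there [p <= q'] already
     holds factor by factor. *)
  move=> k; have [kj|jk] := ltnP k j.
    have [ki|ik] := ltnP k i.
      rewrite (eq_bigr q (op:=*%R) (P:=fun l : 'I_n => (l <= k)%N) (F1:=q'))// => l lk.
      by rewrite q'l//; apply: contraTneq lk => ->; rewrite -ltnNge.
    apply: ler_prod => l lk; rewrite p0 /=.
    have [->|li] := eqVneq l i; first by rewrite q'i.
    have lj : (l < j)%N by exact: leq_ltn_trans kj.
    by rewrite q'l ?before//; apply: contraTneq lj => ->; rewrite ltnn.
  apply: (le_trans (pq k)); rewrite le_eqVlt; apply/orP; left; apply/eqP.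
  have ik : (i <= k)%N by exact: leq_trans (ltnW ij) jk.
  rewrite (bigD1 i)//= (bigD1 j) ?jk 1?eq_sym//= [RHS](bigD1 i)//= [X in _ = _ * X](bigD1 j) ?jk 1?eq_sym//=.
  rewrite q'i q'j !mulrA; congr (_ * _); first by field; rewrite gt_eqF.
  by apply: eq_bigr => l /andP[/andP[_ li] lj]; rewrite q'l.
have qjt : q j <= q j * t by rewrite ler_peMr// ltW.
apply: (@gauge_transfer _ _ _ q q' i j) => //.
- by apply: lt_le_trans qpj _; rewrite (le_trans pji)// ltW.
- by rewrite q'i ut (le_trans qjt)// (le_trans tqj)// (le_trans pji).
rewrite q'i q'j.
have qiE : q i = q i / t * t by rewrite divfK// gt_eqF.
have : q j <= q i / t by apply: le_trans tqi; rewrite (le_trans _ pji)// ltW.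
set w := q i / t in qiE *; rewrite qiE; nra.
Qed.

Lemma prod_powR (R : realType) (I : finType) (P : pred I) (d : I -> R) (s : R) :
  (forall i, 0 <= d i) -> \prod_(i | P i) (d i `^ s) = (\prod_(i | P i) d i) `^ s.
Proof.
move=> d0.
suff : 0 <= \prod_(i | P i) d i /\ \prod_(i | P i) (d i `^ s) = (\prod_(i | P i) d i) `^ s by case.
elim/big_rec2: _ => [|i y x _ [y0 ->]]; first by rewrite powR1.
by rewrite mulr_ge0// powRM.
Qed.

(** Raising to a power [s >= 0] commutes with prefix products, so log-majorization
    survives it, also for [s < 1] where ordinary majorization would not. *)
Lemma gauge_powR_le (R : realType) (n : nat) (N : 'M[R[i]]_n -> R) (s : R) (x y : 'I_n -> R) :
  is_mxnorm N -> unitarily_invariant N -> 0 <= s ->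
  (forall i, 0 <= x i) -> (forall i, 0 <= y i) -> decreasing x ->
  (forall k (hk : (k <= n)%N),
    \prod_i x (widen_ord hk i) <= \prod_i y (widen_ord hk i)) ->
  gauge N (fun i => x i `^ s) <= gauge N (fun i => y i `^ s).
Proof.
move=> hN NUI s0 x0 y0 xdecr xy.
apply: gauge_log_majorized => //; try by move=> i; exact: powR_ge0.
  by move=> i j ij; rewrite ge0_ler_powR ?nnegrE ?xdecr.
move=> k; rewrite !prod_powR//; apply: ge0_ler_powR; rewrite ?nnegrE ?prodr_ge0//.
have hk : (k.+1 <= n)%N by exact: ltn_ord.
have := xy _ hk; rewrite -!(big_ord_narrow hk); exact.
Qed.

(** * Determinants of rectangular products *)

(** Expansion of the determinant by multilinearity in the rows of [A *m B]. *)
Lemma det_mulmx_sum_ffun (K : comNzRingType) (k n : nat) (A : 'M[K]_(k, n)) (B : 'M[K]_(n, k)) :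
  \det (A *m B) =
  \sum_(f : {ffun 'I_k -> 'I_n}) (\prod_i A i (f i)) * \det (rowsub f B).
Proof.
rewrite /determinant.
under eq_bigr => s _.
  under eq_bigr => i _ do rewrite mxE.
  rewrite bigA_distr_bigA /= big_distrr /=; over.
rewrite exchange_big; apply: eq_bigr => f _ /=.
rewrite big_distrr; apply: eq_bigr => s _ /=.
rewrite big_split /= mulrCA; congr (_ * (_ * _)).
by apply: eq_bigr => i _; rewrite mxE.
Qed.

(** The Cauchy-Binet formula, with the sum over all maps instead of increasing
    ones: each set of [k] rows is then counted [k`!] times, and no
    enumeration of subsets is needed.  It follows from the multilinear expansion by
    averaging over the permutations of the domain. *)
Lemma cauchy_binet (K : comNzRingType) (k n : nat) (A : 'M[K]_(k, n)) (B : 'M[K]_(n, k)) :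
  k`!%:R * \det (A *m B) =
  \sum_(f : {ffun 'I_k -> 'I_n}) \det (colsub f A) * \det (rowsub f B).
Proof.
transitivity (\sum_(s : 'S_k) \det (A *m B)).
  by rewrite sumr_const card_Sn mulr_natl.
transitivity (\sum_(s : 'S_k) \sum_(f : {ffun 'I_k -> 'I_n})
    (\prod_i A i (f (s i))) * ((-1) ^+ s * \det (rowsub f B))).
  apply: eq_bigr => s _; rewrite det_mulmx_sum_ffun.
  pose h (t : 'S_k) (f : {ffun 'I_k -> 'I_n}) := [ffun i => f (t i)].
  rewrite (reindex (h s)) /=; last first.
    exists (h s^-1)%g => f _; apply/ffunP => i; rewrite !ffunE ?permK ?permKV //.
  apply: eq_bigr => f _; congr (_ * _); first by apply: eq_bigr => i _; rewrite ffunE.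
  rewrite -det_perm -det_mulmx -row_permE; congr (\det _).
  by apply/matrixP => i j; rewrite !mxE ffunE.
rewrite exchange_big; apply: eq_bigr => f _ /=.
rewrite big_distrl /=; apply: eq_bigr => s _.
rewrite mulrCA mulrA; congr (_ * _ * _).
by apply: eq_bigr => i _; rewrite mxE.
Qed.

Lemma cauchy_schwarz_sum (R : realType) (I : finType) (a b : I -> R[i]) :
  `|\sum_i (a i)^* * b i| ^+ 2 <= (\sum_i (a i)^* * a i) * (\sum_i (b i)^* * b i).
Proof.
pose w (c : I -> R[i]) : 'rV[R[i]]_#|I| := \row_j c (enum_val j).
have wE c d : \sum_i (c i)^* * d i = dotmx (w d) (w c).
  rewrite dotmxE mxE (reindex _ (onW_bij _ (@enum_val_bij I))) /=.
  by apply: eq_bigr => j _; rewrite !mxE mulrC.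
rewrite !wE [leRHS]mulrC.
exact: (CauchySchwarz (@dotmx R[i] #|I|) (w b) (w a)).1.
Qed.

(** Cauchy-Binet presents the determinant of [S^t* *m T] as a hermitian inner
    product of the vectors of maximal minors of [S] and [T]. *)
Lemma gram_det_sum (R : realType) (k n : nat) (S T : 'M[R[i]]_(n, k)) :
  k`!%:R * \det (S^t* *m T) =
    \sum_(f : {ffun 'I_k -> 'I_n}) (\det (rowsub f S))^* * \det (rowsub f T).
Proof.
rewrite cauchy_binet; apply: eq_bigr => f _.
rewrite colsub_adj det_adj; exact: erefl.
Qed.

Lemma gram_det_ge0 (R : realType) (k n : nat) (W : 'M[R[i]]_(n, k)) :
  0 <= \det (W^t* *m W).
Proof.
have k0 : 0 < (k`!%:R : R[i]) by rewrite ltr0n fact_gt0.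
rewrite -(pmulr_rge0 _ k0) gram_det_sum; apply: sumr_ge0 => f _.
by rewrite mulrC -normCK exprn_ge0.
Qed.

Lemma gram_cauchy_schwarz (R : realType) (k n : nat) (P Q : 'M[R[i]]_(n, k)) :
  `|\det (P^t* *m Q)| ^+ 2 <= \det (P^t* *m P) * \det (Q^t* *m Q).
Proof.
have k0 : 0 < (k`!%:R : R[i]) ^+ 2 by rewrite exprn_gt0// ltr0n fact_gt0.
rewrite -(ler_pM2l k0) -[X in X * _ <= _](ger0_norm (ltW k0)).
rewrite normrX -exprMn -normrM gram_det_sum expr2 mulrACA !gram_det_sum.
exact: cauchy_schwarz_sum.
Qed.

(** * Spectral decomposition and functional calculus *)

(** A unitary diagonalization with nonnegative real eigenvalues; the rows of [U]
    are the adjoints of the eigenvectors. *)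
Definition spectral_dec (R : realType) (n : nat) (H U : 'M[R[i]]_n) (d : 'I_n -> R) :=
  [/\ U \is unitarymx, H = U^t* *m diagC d *m U & forall i, 0 <= d i].

Lemma psdmx_spectral (R : realType) (n : nat) (A : 'M[R[i]]_n) :
  psdmx A -> exists U d, spectral_dec A U d.
Proof.
move=> [Aherm Apsd].
have PU := spectral_unitarymx A; set P := spectralmx A in PU.
have /orthomx_spectralP := hermitian_normalmx Aherm.
rewrite -/P (invmx_unitary PU) => AE.
have PAP : P *m A *m P^t* = diag_mx (spectral_diag A).
  rewrite [X in _ *m X *m _]AE !mulmxA (unitary_mulV PU) mul1mx -mulmxA.
  rewrite (unitary_mulV PU) mulmx1; exact: erefl.
have sp0 i : 0 <= spectral_diag A 0 i.
  have := Apsd (P^t* *m delta_mx i 0).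
  rewrite adj_mul adjK -!mulmxA (mulmxA P) (mulmxA (P *m A)) PAP.
  have -> : (delta_mx i 0 : 'cV[R[i]]_n)^t* = delta_mx 0 i.
    by rewrite trmx_delta map_delta_mx.
  by rewrite mulmxA -rowE -colE !mxE eqxx.
have spE : diagC (fun i => complex.Re (spectral_diag A 0 i)) = diag_mx (spectral_diag A).
  by congr diag_mx; apply/rowP => i; rewrite mxE RRe_real// ger0_real.
exists P, (fun i => complex.Re (spectral_diag A 0 i)).
split; [exact: PU|by rewrite spE; exact: AE|move=> i].
by rewrite -ler0c RRe_real// ger0_real.
Qed.

Lemma psdmx_gram (R : realType) (n : nat) (T : 'M[R[i]]_n) : psdmx (T^t* *m T).
Proof.
split; first by rewrite is_hermitianmxE expr0 scale1r adj_mul adjK.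
move=> x; rewrite mulmxA -adj_mul -mulmxA mxE; apply: sumr_ge0 => i _.
by rewrite !mxE mulrC -normCK exprn_ge0.
Qed.

Lemma exists_decreasing_perm (R : realType) (n : nat) (d : 'I_n -> R) :
  exists s : 'S_n, decreasing (fun i => d (s i)).
Proof.
pose l := [tuple d i | i < n].
have sz : size (sort >=%O l) == n by rewrite size_sort size_tuple.
have /tuple_permP[s lE] : perm_eq (Tuple sz) l by rewrite /= perm_sort.
exists s => i j ij.
have tE k : nth 0 (sort >=%O l) (k : 'I_n) = d (s k).
  have -> : sort >=%O l = [tuple tnth l (s i) | i < n] :> seq R by exact: lE.
  by rewrite -tnth_nth !tnth_mktuple.
rewrite -!tE.
apply: (sorted_leq_nth (@ge_trans _ R) (@ge_refl _ R) 0 (sort_sorted (@ge_total _ R) l)) => //.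
- by rewrite inE (eqP sz).
- by rewrite inE (eqP sz).
Qed.

Lemma psdmx_spectral_decreasing (R : realType) (n : nat) (A : 'M[R[i]]_n) :
  psdmx A -> exists U d, spectral_dec A U d /\ decreasing d.
Proof.
move=> /psdmx_spectral[U [d [UU AE d0]]].
have [s sd] := exists_decreasing_perm d.
exists (perm_mx s *m U), (fun i => d (s i)); split; last exact: sd.
split; [exact: mul_unitarymx (perm_mx_unitary R s) UU| |by move=> i; exact: d0].
rewrite AE (diagC_perm s d) adj_mul !mulmxA; exact: erefl.
Qed.

(** The functional calculus does not depend on the diagonalization.  This is what
    allows sorted eigenvalues, and iterated powers such as [|T|^r]. *)
Lemma mxfun_spectral (R : realType) (n : nat) (A U : 'M[R[i]]_n) (d : 'I_n -> R) f :
  spectral_dec A U d -> mxfun f A = U^t* *m diagC (fun i => f (d i)) *m U.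
Proof.
move=> [UU AE _].
have Aherm : A \is hermsymmx.
  by rewrite is_hermitianmxE expr0 scale1r AE !adj_mul adjK diagC_adj mulmxA.
rewrite /mxfun; have PU := spectral_unitarymx A; set P := spectralmx A in PU *.
have AP : A = P^t* *m diag_mx (spectral_diag A) *m P.
  have /orthomx_spectralP := hermitian_normalmx Aherm.
  rewrite -/P (invmx_unitary PU); exact.
rewrite (invmx_unitary PU); set sp := spectral_diag A in AP *.
set D' := diag_mx (map_mx _ _).
(* The transition matrix between two eigenbases only connects equal
   eigenvalues, hence it also intertwines their images under [f]. *)
pose W := P *m U^t*.
have WE : diag_mx sp *m W = W *m diagC d.
  have -> : diag_mx sp *m W = P *m A *m U^t*.
    rewrite AP !mulmxA (unitary_mulV PU) mul1mx -mulmxA; exact: erefl.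
  rewrite AE !mulmxA -[LHS]mulmxA (unitary_mulV UU) mulmx1; exact: erefl.
have PW : P = W *m U by rewrite /W -mulmxA (unitary_mulVl UU) mulmx1.
have PWU : P^t* *m W = U^t* by rewrite /W mulmxA (unitary_mulVl PU) mul1mx.
clearbody W; clear AE AP.
have D'W : D' *m W = W *m diagC (fun i => f (d i)).
  apply/matrixP => i j; have /matrixP/(_ i j) := WE.
  rewrite /D' /diagC !mul_diag_mx !mul_mx_diag !mxE.
  have [->|Wn] := eqVneq (W i j) 0; first by rewrite !mulr0 !mul0r.
  by rewrite mulrC => /(mulfI Wn) ->; rewrite mulrC.
transitivity (P^t* *m (D' *m W) *m U).
  rewrite -!mulmxA -PW; exact: erefl.
rewrite D'W mulmxA PWU; exact: erefl.
Qed.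

Lemma mxpow_add (R : realType) (n : nat) (A : 'M[R[i]]_n) (s t : R) :
  psdmx A -> 0 <= s -> 0 <= t -> A `^mx (s + t) = A `^mx s *m A `^mx t.
Proof.
move=> /psdmx_spectral[U [d Ad]] s0 t0; have [UU _ d0] := Ad.
rewrite /mxpow !(mxfun_spectral _ Ad) !mulmxA -(mulmxA _ U) (unitary_mulV UU) mulmx1.
rewrite -(mulmxA _ (diagC _) (diagC _)) diagC_mul; congr (_ *m diagC _ *m _).
(* The two powers of a zero eigenvalue multiply correctly also when an exponent
   vanishes, because [0 `^ 0 = 1] and the exponents are nonnegative. *)
apply/funext => i; have [st0|st0] := eqVneq (s + t) 0; last first.
  by rewrite powRD//; apply/implyP => /eqP e0; rewrite e0 eqxx in st0.
have -> : s = 0 by lra.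
have -> : t = 0 by lra.
by rewrite addr0 powRr0 mulr1.
Qed.

Lemma mxpow_adj (R : realType) (n : nat) (A : 'M[R[i]]_n) (s : R) :
  psdmx A -> (A `^mx s)^t* = A `^mx s.
Proof.
move=> /psdmx_spectral[U [d Ad]].
rewrite /mxpow (mxfun_spectral _ Ad) !adj_mul adjK diagC_adj mulmxA; exact: erefl.
Qed.

(** * Leading eigenvalues of compressions *)

Lemma prod_le_initial (R : realType) (n k : nat) (hk : (k <= n)%N) (d : 'I_n -> R)
    (f : 'I_k -> 'I_n) :
  (forall i, 0 <= d i) -> decreasing d ->
  injective f -> \prod_i d (f i) <= \prod_i d (widen_ord hk i).
Proof.
move=> d0 ddecr; elim: k hk f => [|k IH] hk f finj; first by rewrite !big_ord0.
(* An injection of [k + 1] indices must take a value that is at least [k]. *)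
have [i0 ki0] : exists i0 : 'I_k.+1, (k <= f i0)%N.
  apply/existsP; apply: contraT; rewrite negb_exists => /forallP H.
  have ltk i : (f i < k)%N by have := H i; rewrite -ltnNge.
  have ginj : injective (fun i => Ordinal (ltk i)).
    by move=> i j [] /val_inj /finj.
  by have := leq_card _ ginj; rewrite !card_ord ltnn.
rewrite (bigD1 i0)//= big_ord_recr /= mulrC.
have -> : \prod_(i < k.+1 | i != i0) d (f i) = \prod_(i < k) d (f (lift i0 i)).
  rewrite (big_mkcond (fun i => i != i0)) (bigD1_ord i0)//= eqxx mul1r.
  by apply: eq_bigr => i _; rewrite eq_sym neq_lift.
apply: ler_pM; rewrite ?d0 ?prodr_ge0//.
  have hk' : (k <= n)%N by exact: ltnW.
  apply: (le_trans (IH hk' (fun i => f (lift i0 i)) _)).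
    by move=> i j /finj /lift_inj.
  rewrite le_eqVlt; apply/orP; left; apply/eqP; apply: eq_bigr => i _; congr d.
  exact/val_inj.
exact: ddecr.
Qed.

(** Compression cannot beat the leading eigenvalues.  In an eigenbasis of [H],
    Cauchy-Binet writes the left-hand determinant as a sum of squared moduli of
    minors of [W], each weighted by a product of [k] eigenvalues with distinct
    indices. *)
Lemma det_compress_le (R : realType) (n k : nat) (hk : (k <= n)%N) (H U : 'M[R[i]]_n)
    (d : 'I_n -> R) (W : 'M[R[i]]_(n, k)) :
  spectral_dec H U d -> decreasing d ->
  \det (W^t* *m H *m W) <= (\prod_i d (widen_ord hk i))%:C * \det (W^t* *m W).
Proof.
move=> [UU HE d0] ddecr.
pose Z := U *m W.
have E1 : W^t* *m H *m W = Z^t* *m (diagC d *m Z).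
  rewrite HE /Z adj_mul !mulmxA; exact: erefl.
have E2 : W^t* *m W = Z^t* *m Z.
  rewrite /Z adj_mul mulmxA -(mulmxA _ (U^t*)) (unitary_mulVl UU) mulmx1; exact: erefl.
have k0 : 0 < (k`!%:R : R[i]) by rewrite ltr0n fact_gt0.
rewrite E1 E2 -(ler_pM2l k0) mulrCA !gram_det_sum mulr_sumr.
apply: ler_sum => f _.
have -> : rowsub f (diagC d *m Z) = diagC (fun i => d (f i)) *m rowsub f Z.
  apply/matrixP => i j; rewrite mxE /diagC !mul_diag_mx !mxE; exact: erefl.
rewrite det_mulmx det_diagC mulrCA.
(* A repeated index gives a minor with two equal rows. *)
have [/injectiveP finj|] := boolP (injectiveb f).
  apply: ler_wpM2r; first by rewrite mulrC -normCK exprn_ge0.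
  by rewrite lecR; exact: prod_le_initial.
move=> /injectivePn[i [j ij fij]].
have -> : \det (rowsub f Z) = 0.
  by apply: (determinant_alternate ij) => l; rewrite !mxE fij.
by rewrite !mulr0.
Qed.

(** The first [k] eigenvectors, as the columns of an isometry that compresses every
    function [g] of the diagonalized matrix simultaneously. *)
Lemma eigenframe (R : realType) (n k : nat) (hk : (k <= n)%N) (U : 'M[R[i]]_n) :
  U \is unitarymx -> exists W : 'M[R[i]]_(n, k), W^t* *m W = 1%:M /\
    forall g : 'I_n -> R,
    W^t* *m (U^t* *m diagC g *m U) *m W = diagC (fun i => g (widen_ord hk i)).
Proof.
move=> UU; pose E : 'M[R[i]]_(k, n) := rowsub (widen_ord hk) 1%:M.
pose W := U^t* *m E^t*.
have WE (g : 'I_n -> R) :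
    W^t* *m (U^t* *m diagC g *m U) *m W = diagC (fun i => g (widen_ord hk i)).
  rewrite adj_mul !adjK !mulmxA -(mulmxA E U) (unitary_mulV UU) mulmx1.
  rewrite -(mulmxA _ U) (unitary_mulV UU) mulmx1.
  have -> : E *m diagC g = rowsub (widen_ord hk) (diagC g) by rewrite /E -rowsubE.
  apply/matrixP => i j; rewrite !mxE (bigD1 (widen_ord hk j)) //= big1 ?addr0.
    rewrite !mxE eqxx conjC1 mulr1 -val_eqE /=; exact: erefl.
  by move=> l lj; rewrite !mxE (eq_sym (widen_ord hk j)) (negbTE lj) conjC0 mulr0.
exists W; split; last exact: WE.
have diagC1 m : diagC (fun=> 1) = 1%:M :> 'M[R[i]]_m.
  by apply/matrixP => i j; rewrite !mxE.
have := WE (fun=> 1).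
rewrite !diagC1 mulmx1 (unitary_mulVl UU) mulmx1; exact.
Qed.

(** * Norms of powers of the modulus *)

(** The exponent is [r / 2] because [d] lists the eigenvalues of [T^t* *m T], the
    squares of the singular values. *)
Lemma normabs_spectral (R : realType) (n : nat) (N : 'M[R[i]]_n -> R) (r : R)
    (T U : 'M[R[i]]_n) (d : 'I_n -> R) :
  unitarily_invariant N -> spectral_dec (T^t* *m T) U d ->
  normabs N r T = gauge N (fun i => d i `^ (r / 2)).
Proof.
move=> NUI Td; have [UU _ d0] := Td.
have absE : spectral_dec (mxabs T) U (fun i => d i `^ (1 / 2)).
  split; [exact: UU|exact: mxfun_spectral|by move=> i; exact: powR_ge0].
rewrite /normabs /mxpow (mxfun_spectral _ absE) NUI ?trmxC_unitary//.
rewrite /gauge; congr (N (diagC _)); apply/funext => i.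
by rewrite -powRrM; congr (_ `^ _); field.
Qed.

(** The nonzero eigenvalues of [T *m T^t*] and [T^t* *m T] agree.  One half of this,
    in the form of prefix products, is what [gauge_powR_le] needs, and it follows
    from [det_compress_le]; the other half is the same statement for the
    adjoint. *)
Lemma normabs_adj_le (R : realType) (n : nat) (N : 'M[R[i]]_n -> R) (r : R) (T : 'M[R[i]]_n) :
  is_mxnorm N -> unitarily_invariant N -> 0 <= r ->
  normabs N r (T^t*) <= normabs N r T.
Proof.
move=> hN NUI r0.
have [U [x [Tx xdecr]]] := psdmx_spectral_decreasing (psdmx_gram T).
have [V [y [Ty ydecr]]] := psdmx_spectral_decreasing (psdmx_gram (T^t*)).
rewrite (normabs_spectral r NUI Tx) (normabs_spectral r NUI Ty).
have [UU _ x0] := Tx; have [VV TyE y0] := Ty; rewrite adjK in TyE.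
apply: gauge_powR_le => //; first by rewrite divr_ge0.
move=> k hk.
have [W [_ WE]] := eigenframe hk VV.
(* On the frame [W] of leading eigenvectors of [T *m T^t*], the compression of
   [T^t* *m T] to [K] has determinant [(\prod y) ^+ 2], and [K] itself has Gram
   determinant [\prod y]. *)
pose K := T^t* *m W.
have KK : K^t* *m K = diagC (fun i => y (widen_ord hk i)).
  rewrite -WE -TyE /K adj_mul adjK !mulmxA; exact: erefl.
have KTK : K^t* *m (T^t* *m T) *m K = diagC (fun i => y (widen_ord hk i) * y (widen_ord hk i)).
  rewrite -(WE (fun i => y i * y i)) -diagC_mul.
  transitivity (W^t* *m ((T *m T^t*) *m (T *m T^t*)) *m W).
    rewrite /K adj_mul adjK !mulmxA; exact: erefl.
  rewrite TyE; congr (_ *m _ *m _).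
  rewrite !mulmxA -(mulmxA _ V) (unitary_mulV VV) mulmx1 ; exact: erefl.
have := det_compress_le hk K Tx xdecr.
rewrite KK KTK !det_diagC -rmorphM lecR big_split /=.
have : 0 <= \prod_(i < k) y (widen_ord hk i) by apply: prodr_ge0.
rewrite le_eqVlt => /predU1P[<- _|yp]; first by apply: prodr_ge0.
by rewrite ler_pM2r.
Qed.

Lemma normabs_adj (R : realType) (n : nat) (N : 'M[R[i]]_n -> R) (r : R) (T : 'M[R[i]]_n) :
  is_mxnorm N -> unitarily_invariant N -> 0 <= r ->
  normabs N r (T^t*) = normabs N r T.
Proof.
move=> hN NUI r0; apply: le_anti; apply/andP; split.
  exact: normabs_adj_le.
rewrite -{1}(adjK T); exact: normabs_adj_le.
Qed.

Lemma sqrtr_powRM (R : realType) (s y z : R) : 0 <= y -> 0 <= z ->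
  Num.sqrt (y `^ s) * Num.sqrt (z `^ s) = Num.sqrt (y * z) `^ s.
Proof.
move=> y0 z0; rewrite -sqrtrM ?powR_ge0// -powRM//.
rewrite -(powR12_sqrt (powR_ge0 _ _)) -(powR12_sqrt (mulr_ge0 y0 z0)).
by rewrite -!powRrM (mulrC s).
Qed.

Lemma prod_sqrtr (R : realType) (I : finType) (d : I -> R) :
  (forall i, 0 <= d i) -> \prod_i Num.sqrt (d i) = Num.sqrt (\prod_i d i).
Proof.
move=> d0.
suff : 0 <= \prod_i d i /\ \prod_i Num.sqrt (d i) = Num.sqrt (\prod_i d i) by case.
elim/big_rec2: _ => [|i u v _ [u0 ->]]; first by rewrite sqrtr1.
by rewrite mulr_ge0// sqrtrM.
Qed.

(** A Cauchy-Schwarz inequality for powers of the modulus.  The products of the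
    leading eigenvalues of [T^t* *m T] are Gram-type determinants of [P *m W] and
    [Q *m W], so they are controlled by those of [P^t* *m P] and [Q^t* *m Q].  The
    case [r < 1], where [N (|T|^r)] is not a norm of [T], is covered because only
    products of eigenvalues are compared. *)
Lemma normabs_gram_le (R : realType) (n : nat) (N : 'M[R[i]]_n -> R) (r : R)
    (T P Q : 'M[R[i]]_n) :
  is_mxnorm N -> unitarily_invariant N -> 0 <= r ->
  T^t* *m T = P^t* *m Q ->
  normabs N r T ^+ 2 <= normabs N r P * normabs N r Q.
Proof.
move=> hN NUI r0 TPQ.
have [U [x [Tx xdecr]]] := psdmx_spectral_decreasing (psdmx_gram T).
have [V [y [Py ydecr]]] := psdmx_spectral_decreasing (psdmx_gram P).
have [V' [z [Qz zdecr]]] := psdmx_spectral_decreasing (psdmx_gram Q).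
rewrite (normabs_spectral r NUI Tx) (normabs_spectral r NUI Py) (normabs_spectral r NUI Qz).
have [UU TxE x0] := Tx; have [_ _ y0] := Py; have [_ _ z0] := Qz.
have r20 : 0 <= r / 2 by rewrite divr_ge0.
apply: le_trans (gauge_cauchy_schwarz hN NUI _ _); last 2 first.
- by move=> i; exact: powR_ge0.
- by move=> i; exact: powR_ge0.
have ge0 v : 0 <= gauge N v by case: hN => + _ _ _; apply.
rewrite ler_sqr ?nnegrE ?ge0//.
have -> : (fun i => Num.sqrt (y i `^ (r / 2)) * Num.sqrt (z i `^ (r / 2))) =
          (fun i => (Num.sqrt (y i * z i)) `^ (r / 2)).
  by apply/funext => i; exact: sqrtr_powRM.
apply: gauge_powR_le => //.
move=> k hk.
have [W [W1 WE]] := eigenframe hk UU.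
have WTW : W^t* *m (T^t* *m T) *m W = diagC (fun i => x (widen_ord hk i)).
  rewrite TxE WE; exact: erefl.
have := gram_cauchy_schwarz (P *m W) (Q *m W).
have -> : (P *m W)^t* *m (Q *m W) = W^t* *m (T^t* *m T) *m W.
  rewrite TPQ adj_mul !mulmxA; exact: erefl.
have gramE (S : 'M[R[i]]_n) : (S *m W)^t* *m (S *m W) = W^t* *m (S^t* *m S) *m W.
  rewrite adj_mul !mulmxA; exact: erefl.
have bound (S V0 : 'M[R[i]]_n) d : spectral_dec (S^t* *m S) V0 d -> decreasing d ->
    0 <= \det ((S *m W)^t* *m (S *m W)) <= (\prod_i d (widen_ord hk i))%:C.
  move=> Sd dd; rewrite gram_det_ge0 gramE.
  by have := det_compress_le hk W Sd dd; rewrite W1 det1 mulr1.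
rewrite WTW det_diagC.
have /andP[P0 Ple] := bound _ _ _ Py ydecr.
have /andP[Q0 Qle] := bound _ _ _ Qz zdecr.
move=> /le_trans/(_ (ler_pM P0 Q0 Ple Qle)).
rewrite ger0_norm ?ler0c ?prodr_ge0// -rmorphXn -rmorphM lecR => le2.
have -> : \prod_(i < k) Num.sqrt (y (widen_ord hk i) * z (widen_ord hk i)) =
   Num.sqrt ((\prod_i y (widen_ord hk i)) * (\prod_i z (widen_ord hk i))).
  by rewrite -big_split prod_sqrtr// => i; rewrite mulr_ge0.
rewrite -(ler_sqr _ _) ?nnegrE ?sqrtr_ge0 ?prodr_ge0// sqr_sqrtr; first exact: le2.
by rewrite mulr_ge0 ?prodr_ge0.
Qed.

(** The hypotheses give [T^t* *m T = S^t* *m T']. *)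
Lemma normabs_mull_midpoint (R : realType) (n : nat) (N : 'M[R[i]]_n -> R) (r : R)
    (E S T T' : 'M[R[i]]_n) :
  is_mxnorm N -> unitarily_invariant N -> 0 <= r ->
  E^t* = E -> T = E *m S -> T' = E *m T ->
  normabs N r T ^+ 2 <= normabs N r S * normabs N r T'.
Proof.
move=> hN NUI r0 EE TE T'E; apply: (normabs_gram_le hN NUI r0).
rewrite T'E {1}TE adj_mul EE mulmxA; exact: erefl.
Qed.

(** The adjoint of [normabs_mull_midpoint]. *)
Lemma normabs_mulr_midpoint (R : realType) (n : nat) (N : 'M[R[i]]_n -> R) (r : R)
    (E S T T' : 'M[R[i]]_n) :
  is_mxnorm N -> unitarily_invariant N -> 0 <= r ->
  E^t* = E -> T = S *m E -> T' = T *m E ->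
  normabs N r T ^+ 2 <= normabs N r S * normabs N r T'.
Proof.
move=> hN NUI r0 EE TE T'E.
have := @normabs_mull_midpoint R n N r E (S^t*) (T^t*) (T'^t*) hN NUI r0 EE.
rewrite !(normabs_adj _ hN NUI r0); apply.
  rewrite TE adj_mul EE; exact: erefl.
rewrite T'E adj_mul EE; exact: erefl.
Qed.

Lemma normabs_mxpowl_midpoint (R : realType) (n : nat) (N : 'M[R[i]]_n -> R) (r : R)
    (A X Y : 'M[R[i]]_n) (s t : R) :
  is_mxnorm N -> unitarily_invariant N -> 0 <= r -> psdmx A -> 0 <= s -> 0 <= t ->
  normabs N r (A `^mx ((s + t) / 2) *m X *m Y) ^+ 2 <=
  normabs N r (A `^mx s *m X *m Y) * normabs N r (A `^mx t *m X *m Y).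
Proof.
move=> hN NUI r0 Apsd.
wlog st : s t / s <= t.
  move=> W s0 t0; have [st|/ltW ts] := leP s t; first exact: (W s t st s0 t0).
  rewrite (addrC s) [leRHS]mulrC; exact: (W t s ts t0 s0).
move=> s0 t0; pose m := (s + t) / 2; pose e := (t - s) / 2.
have e0 : 0 <= e by rewrite /e; lra.
have m0 : 0 <= m by rewrite /m; lra.
have mE : A `^mx m = A `^mx e *m A `^mx s.
  by rewrite -(mxpow_add Apsd e0 s0); congr (mxpow A _); rewrite /m /e; field.
have tE : A `^mx t = A `^mx e *m A `^mx m.
  by rewrite -(mxpow_add Apsd e0 m0); congr (mxpow A _); rewrite /m /e; field.
have assoc (C D : 'M[R[i]]_n) : C *m D *m X *m Y = C *m (D *m X *m Y).
  by rewrite !mulmxA.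
apply: (normabs_mull_midpoint hN NUI r0 (mxpow_adj e Apsd)).
  exact: etrans (congr1 (fun Z => Z *m X *m Y) mE) (assoc _ _).
exact: etrans (congr1 (fun Z => Z *m X *m Y) tE) (assoc _ _).
Qed.

Lemma normabs_mxpowr_midpoint (R : realType) (n : nat) (N : 'M[R[i]]_n -> R) (r : R)
    (B Z : 'M[R[i]]_n) (s t : R) :
  is_mxnorm N -> unitarily_invariant N -> 0 <= r -> psdmx B -> 0 <= s -> 0 <= t ->
  normabs N r (Z *m B `^mx ((s + t) / 2)) ^+ 2 <=
  normabs N r (Z *m B `^mx s) * normabs N r (Z *m B `^mx t).
Proof.
move=> hN NUI r0 Bpsd.
wlog st : s t / s <= t.
  move=> W s0 t0; have [st|/ltW ts] := leP s t; first exact: (W s t st s0 t0).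
  rewrite (addrC s) [leRHS]mulrC; exact: (W t s ts t0 s0).
move=> s0 t0; pose m := (s + t) / 2; pose e := (t - s) / 2.
have e0 : 0 <= e by rewrite /e; lra.
have m0 : 0 <= m by rewrite /m; lra.
have mE : B `^mx m = B `^mx s *m B `^mx e.
  by rewrite -(mxpow_add Bpsd s0 e0); congr (mxpow B _); rewrite /m /e; field.
have tE : B `^mx t = B `^mx m *m B `^mx e.
  by rewrite -(mxpow_add Bpsd m0 e0); congr (mxpow B _); rewrite /m /e; field.
apply: (normabs_mulr_midpoint hN NUI r0 (mxpow_adj e Bpsd)).
  exact: etrans (congr1 (mulmx Z) mE) (mulmxA _ _ _).
exact: etrans (congr1 (mulmx Z) tE) (mulmxA _ _ _).
Qed.

(** * A uniform bound on the unit square *)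

Definition entries_le (R : realType) (m n : nat) (c : R[i]) (M : 'M[R[i]]_(m, n)) :=
  forall i j, `|M i j| <= c.

Lemma entries_le_exists (R : realType) (m n : nat) (M : 'M[R[i]]_(m, n)) :
  exists2 c, 0 <= c & entries_le c M.
Proof.
exists (\sum_i \sum_j `|M i j|); first by do 2!apply: sumr_ge0 => ? _.
move=> i j; rewrite (bigD1 i)//= (bigD1 j)//= -addrA lerDl addr_ge0//.
  by apply: sumr_ge0.
by do 2!apply: sumr_ge0 => ? _.
Qed.

Lemma entries_le_mul (R : realType) (m n p : nat) (c c' : R[i]) (M : 'M[R[i]]_(m, n))
    (M' : 'M[R[i]]_(n, p)) : entries_le c M -> entries_le c' M' ->
  entries_le (n%:R * (c * c')) (M *m M').
Proof.
move=> Mc Mc' i j; rewrite mxE; apply: (le_trans (ler_norm_sum _ _ _)).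
rewrite -[n in n%:R]card_ord mulr_natl -sumr_const; apply: ler_sum => l _.
by rewrite normrM ler_pM.
Qed.

Lemma entries_le_adj (R : realType) (m n : nat) (c : R[i]) (M : 'M[R[i]]_(m, n)) :
  entries_le c M -> entries_le c (M^t*).
Proof. by move=> Mc i j; rewrite !mxE norm_conjC. Qed.

(** For exponents in the unit interval, an eigenvalue [d] satisfies
    [d `^ s <= 1 + d]; the bound is therefore uniform also for singular [A], where
    [s |-> A `^mx s] jumps at [0]. *)
Lemma mxpow_entries_le (R : realType) (n : nat) (A : 'M[R[i]]_n) :
  psdmx A -> exists c, forall s, 0 <= s <= 1 -> entries_le c (A `^mx s).
Proof.
move=> /psdmx_spectral[U [d Ad]]; have [_ _ d0] := Ad.
have [c c0 Uc] := entries_le_exists U.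
pose K := (1 + \sum_i d i)%:C.
exists (n%:R * ((n%:R * (c * K)) * c)) => s /andP[s0 s1].
rewrite /mxpow (mxfun_spectral _ Ad); apply: entries_le_mul => //.
apply: entries_le_mul; first exact: entries_le_adj.
move=> i j; rewrite !mxE; have S0 : 0 <= \sum_i d i by exact: sumr_ge0.
have K0 : 0 <= 1 + \sum_i d i by rewrite addr_ge0.
case: (i == j) => /=; last by rewrite mulr0n normr0 ler0c.
rewrite mulr1n ger0_norm ?ler0c ?powR_ge0// lecR.
have di : d i <= \sum_i d i by rewrite (bigD1 i)//= lerDl sumr_ge0.
have [d1|d1] := leP (d i) 1.
  have : d i `^ s <= 1 `^ s by rewrite ge0_ler_powR// nnegrE.
  rewrite powR1; lra.
have : d i `^ s <= d i `^ 1 by rewrite ler_powR// ltW.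
rewrite powRr1//; lra.
Qed.

(** Each eigenvalue of [T^t* *m T] is at most its trace. *)
Lemma normabs_entries_le (R : realType) (n : nat) (N : 'M[R[i]]_n -> R) (r : R) (c : R[i]) :
  is_mxnorm N -> unitarily_invariant N -> 0 <= r ->
  exists K, forall T, entries_le c T -> normabs N r T <= K.
Proof.
move=> hN NUI r0.
pose b := complex.Re (n%:R * (n%:R * (c * c))).
exists (gauge N (fun=> b `^ (r / 2))) => T Tc.
have [U [d Td]] := psdmx_spectral (psdmx_gram T).
have [UU TE d0] := Td.
rewrite (normabs_spectral r NUI Td); apply: gauge_le => // i.
rewrite powR_ge0 /=.
have dtr : (\sum_i d i)%:C = \tr (T^t* *m T).
  rewrite TE mxtrace_mulC mulmxA (unitary_mulV UU) mul1mx /mxtrace rmorph_sum.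
  by apply: eq_bigr => j _; rewrite !mxE eqxx.
have db : (d i)%:C <= n%:R * (n%:R * (c * c)).
  apply: (@le_trans _ _ (\sum_i d i)%:C).
    by rewrite lecR (bigD1 i)//= lerDl sumr_ge0.
  have sum0 : 0 <= (\sum_i d i)%:C by rewrite ler0c sumr_ge0.
  rewrite -(ger0_norm sum0) dtr /mxtrace; apply: (le_trans (ler_norm_sum _ _ _)).
  rewrite -[n in n%:R * _]card_ord mulr_natl -sumr_const; apply: ler_sum => l _.
  by apply: entries_le_mul; first exact: entries_le_adj.
have bd : d i <= b by move: db; rewrite lecE => /andP[].
apply: ge0_ler_powR; rewrite ?nnegrE ?divr_ge0//.
exact: le_trans bd.
Qed.

Lemma normabs_mxpow2_bounded (R : realType) (n : nat) (N : 'M[R[i]]_n -> R) (r : R)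
    (A B X : 'M[R[i]]_n) :
  is_mxnorm N -> unitarily_invariant N -> 0 <= r -> psdmx A -> psdmx B ->
  exists K, forall s u, 0 <= s <= 1 -> 0 <= u <= 1 ->
    normabs N r (A `^mx s *m X *m B `^mx u) <= K.
Proof.
move=> hN NUI r0 /mxpow_entries_le[a Aa] /mxpow_entries_le[b Bb].
have [x _ Xx] := entries_le_exists X.
have [K KP] := normabs_entries_le (n%:R * ((n%:R * (a * x)) * b)) hN NUI r0.
exists K => s u s01 u01; apply: KP.
by apply: entries_le_mul (Bb u u01); apply: entries_le_mul (Aa s s01) Xx.
Qed.

(** * Bounded midpoint convex functions *)

Definition midconvex_on (R : realType) (c d : R) (f : R -> R) :=
  forall x y, c <= x <= d -> c <= y <= d -> f ((x + y) / 2) <= (f x + f y) / 2.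

(** Nonnegativity is part of the bound because it makes every chord of [f]
    nonnegative, so that the difference of [f] and a chord is still at most [M]. *)
Definition bounded_on (R : realType) (c d M : R) (f : R -> R) :=
  forall x, c <= x <= d -> 0 <= f x <= M.

(** A bounded midpoint convex function is convex.  The conclusion is the chord
    inequality cleared of denominators, so that it also makes sense for
    [x = y]. *)
Lemma midconvex_le_chord (R : realType) (c d M : R) (f : R -> R) :
  bounded_on c d M f -> midconvex_on c d f ->
  forall x z y, c <= x -> x <= z -> z <= y -> y <= d ->
    f z * (y - x) <= f x * (y - z) + f y * (z - x).
Proof.
move=> fM fmid x z y cx xz zy yd.
have [exy|xy] := eqVneq x y; first by rewrite -exy in zy *; have -> : z = x by [lra]; rewrite !subrr !mulr0 addr0.
have {}xy : x < y by rewrite lt_neqAle xy (le_trans xz zy).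
pose l w := (f x * (y - w) + f y * (w - x)) / (y - x).
pose h w := f w - l w.
have yx0 : y - x != 0 by rewrite subr_eq0 gt_eqF.
have lmid u v : l ((u + v) / 2) = (l u + l v) / 2 by rewrite /l; field.
have l0 w : x <= w <= y -> 0 <= l w.
  move=> /andP[xw wy]; apply: divr_ge0; last by rewrite subr_ge0 ltW.
  have /andP[fx0 _] := fM x ltac:(lra); have /andP[fy0 _] := fM y ltac:(lra).
  by rewrite addr_ge0// mulr_ge0// subr_ge0.
have hM w : x <= w <= y -> h w <= M.
  move=> xwy; have /andP[_ fw] : 0 <= f w <= M by apply: fM; lra.
  by rewrite /h; have := l0 _ xwy; lra.
(* [h] vanishes at both ends, and every point of the interval is the midpoint of
   an end and another point; so the supremum of [h] is at most half of itself. *)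
pose S := sup [set h w | w in [set w | x <= w <= y]].
have hS w : x <= w <= y -> h w <= S.
  move=> xwy; apply: ub_le_sup; last by exists w.
  by exists M => _ [v xvy <-]; exact: hM.
have hx : h x = 0 by rewrite /h /l; field.
have hy : h y = 0 by rewrite /h /l; field.
have S0 : 0 <= S by rewrite -hx hS// lexx ltW.
have hmid u v : x <= u <= y -> x <= v <= y -> h ((u + v) / 2) <= (h u + h v) / 2.
  move=> xu xv; rewrite /h lmid.
  have : f ((u + v) / 2) <= (f u + f v) / 2 by apply: fmid; lra.
  lra.
have hS2 w : x <= w <= y -> h w <= S / 2.
  move=> xwy; have [wm|mw] := lerP w ((x + y) / 2).
    have -> : w = (x + (2 * w - x)) / 2 by lra.
    have := hmid x (2 * w - x); have := hS (2 * w - x); lra.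
  have -> : w = ((2 * w - y) + y) / 2 by lra.
  have := hmid (2 * w - y) y; have := hS (2 * w - y); lra.
have : S <= S / 2.
  apply: ge_sup; first by exists (h x), x => //=; rewrite lexx ltW.
  by move=> _ [w xwy <-]; exact: hS2.
move=> SS; have := hS z; rewrite /h => hz.
have {hz} : f z <= l z by have := hz; lra.
by rewrite /l ler_pdivlMr ?subr_gt0.
Qed.

(** Sublevel sets of a convex function are intervals.  This covers the
    end points, where continuity may fail. *)
Lemma midconvex_measurable (R : realType) (c d M : R) (f : R -> R) :
  bounded_on c d M f -> midconvex_on c d f ->
  measurable_fun `[c, d]%classic f.
Proof.
move=> fM fmid; have chord := midconvex_le_chord fM fmid.
move=> mD; apply: (measurability _ (RGenInftyO.measurableE R)) => //.
move=> _ [_ [r ->] <-]; apply: is_interval_measurable => x y /=.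
rewrite !in_itv/= => -[/andP[cx xd] fx] [/andP[cy yd] fy] z /andP[xz zy].
have cz : c <= z by lra.
have zd : z <= d by lra.
split => /=; rewrite in_itv/= ?cz ?zd//.
have [xy|xy] := eqVneq x y; first by have -> : z = x by lra.
have {}xy : x < y by rewrite lt_neqAle xy (le_trans xz zy).
have := chord x z y cx xz zy yd.
rewrite -(@ltr_pM2r _ (y - x)) ?subr_gt0 // => /le_lt_trans; apply.
have -> : r * (y - x) = r * (y - z) + r * (z - x) by ring.
have [xz'|xz'] := eqVneq x z.
  by rewrite -xz' subrr !mulr0 !addr0 ltr_pM2r ?subr_gt0.
by rewrite ler_ltD ?ler_wpM2r ?subr_ge0 ?(ltW fx)// ltr_pM2r// subr_gt0 lt_neqAle xz'.
Qed.

Lemma midconvex_integrable (R : realType) (c d M : R) (f : R -> R) :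
  bounded_on c d M f -> midconvex_on c d f ->
  lebesgue_measure.-integrable `[c, d]%classic (EFin \o f).
Proof.
move=> fM fmid; apply: measurable_bounded_integrable => //.
- by rewrite /= lebesgue_measure_itv/=; case: ifP => _; rewrite ?ltry// -EFinD ltry.
- exact: midconvex_measurable fM fmid.
exists M; split; first exact: num_real.
move=> x Mx y /=; rewrite in_itv/= => /fM /andP[f0 f1].
by rewrite ger0_norm// (le_trans f1)// ltW.
Qed.

Lemma Rintegral_affine (R : realType) (c d p q : R) : c < d ->
  lebesgue_measure.-integrable `[c, d]%classic
    (EFin \o (fun x => p + q * (x - (c + d) / 2))) /\
  \int[lebesgue_measure]_(x in `[c, d]) (p + q * (x - (c + d) / 2)) = p * (d - c).
Proof.
move=> cd.
have cg : continuous (fun x : R => p + q * (x - (c + d) / 2)).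
  move=> x; apply: cvgD; first exact: cvg_cst.
  apply: cvgMr; apply: cvgB; [exact: cvg_id|exact: cvg_cst].
have cgw : {within `[c, d], continuous (fun x : R => p + q * (x - (c + d) / 2))}.
  exact: continuous_subspaceT.
split.
  by apply: continuous_compact_integrable => //; exact: segment_compact.
pose G x : R := p * x + q / 2 * (x - (c + d) / 2) ^+ 2.
have dG (x : R) : is_derive x 1 G (p + q * (x - (c + d) / 2)).
  by rewrite /G; apply: is_derive_eq; rewrite /GRing.scale/=; field.
transitivity (fine ((G d)%:E - (G c)%:E)%E); last by rewrite -EFinB /= /G; field.
congr fine; apply: (continuous_FTC2 cd cgw).
- have cG : continuous G.
    by move=> x; apply: differentiable_continuous; apply/derivable1_diffP; case: (dG x).
  split.
  + by move=> x _; case: (dG x).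
  + by apply: cvg_at_right_filter; exact: cG.
  + by apply: cvg_at_left_filter; exact: cG.
- by move=> x _; rewrite derive1E; have [_ ->] := dG x.
Qed.

Lemma midconvex_support (R : realType) (c d M : R) (f : R -> R) :
  c < d -> bounded_on c d M f -> midconvex_on c d f ->
  exists k, forall x, c <= x <= d ->
    f ((c + d) / 2) + k * (x - (c + d) / 2) <= f x.
Proof.
move=> cd fM fmid; have chord := midconvex_le_chord fM fmid.
pose m := (c + d) / 2; rewrite -/m.
have cm : c < m by rewrite /m; lra.
have md : m < d by rewrite /m; lra.
(* Every slope from the left of the midpoint is at most every slope to its
   right; the supremum of the left slopes separates them. *)
pose E := [set (f m - f x) / (m - x) | x in [set x | c <= x < m]].
have EB y : m < y <= d -> ubound E ((f y - f m) / (y - m)).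
  move=> /andP[my yd] _ [x /andP[cx xm] <-].
  rewrite ler_pdivrMr ?subr_gt0// mulrAC ler_pdivlMr ?subr_gt0//.
  have := chord x m y cx (ltW xm) (ltW my) yd; nra.
have E0 : E !=set0 by exists ((f m - f c) / (m - c)), c => //=; rewrite lexx cm.
exists (sup E) => x /andP[cx xd].
have [xm|mx|->] := ltgtP x m.
- have : (f m - f x) / (m - x) <= sup E.
    apply: ub_le_sup; last by exists x => //=; rewrite cx xm.
    by exists ((f d - f m) / (d - m)); apply: EB; rewrite md lexx.
  rewrite ler_pdivrMr ?subr_gt0//; nra.
- have : sup E <= (f x - f m) / (x - m) by apply: ge_sup => //; apply: EB; rewrite mx.
  rewrite ler_pdivlMr ?subr_gt0//; nra.
- by rewrite subrr mulr0 addr0.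
Qed.

(** Integrate the bounds of [f] by its chord from above and by a supporting
    line at the midpoint from below; both are affine, and the linear term about
    the midpoint integrates to zero. *)
Lemma hermite_hadamard (R : realType) (c d M : R) (f : R -> R) :
  c < d -> bounded_on c d M f -> midconvex_on c d f ->
  f ((c + d) / 2) * (d - c) <= \int[lebesgue_measure]_(x in `[c, d]) f x
    <= (f c + f d) / 2 * (d - c).
Proof.
move=> cd fM fmid; have fi := midconvex_integrable fM fmid.
have [k kP] := midconvex_support cd fM fmid.
have chord := midconvex_le_chord fM fmid.
apply/andP; split.
  have [gi <-] := Rintegral_affine (f ((c + d) / 2)) k cd.
  by apply: le_Rintegral => // x /=; rewrite in_itv/= => /kP.
have [gi <-] := Rintegral_affine ((f c + f d) / 2) ((f d - f c) / (d - c)) cd.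
apply: le_Rintegral => // x /=; rewrite in_itv/= => /andP[cx xd].
have := chord c x d (lexx _) cx xd (lexx _).
rewrite -ler_pdivlMr ?subr_gt0// => /le_trans; apply.
rewrite le_eqVlt; apply/orP; left; apply/eqP; field.
by rewrite subr_eq0 gt_eqF.
Qed.

(** * Hermite-Hadamard inequalities on the square *)

Lemma integrable_EFinD (R : realType) (D : set (measurableTypeR R)) (f g : R -> R) :
  measurable D ->
  lebesgue_measure.-integrable D (EFin \o f) ->
  lebesgue_measure.-integrable D (EFin \o g) ->
  lebesgue_measure.-integrable D (EFin \o (fun x => f x + g x)).
Proof. by move=> mD fi gi; apply: eq_integrable (integrableD mD fi gi). Qed.

Lemma integrable_EFinZr (R : realType) (D : set (measurableTypeR R)) (f : R -> R) (k : R) :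
  measurable D ->
  lebesgue_measure.-integrable D (EFin \o f) ->
  lebesgue_measure.-integrable D (EFin \o (fun x => f x * k)).
Proof. by move=> mD fi; apply: eq_integrable (integrableZr mD k fi). Qed.

(** Integrating out one variable preserves the hypotheses of [hermite_hadamard];
    this takes the place of Fubini's theorem in the double integrals. *)
Lemma Rintegral_midconvex (R : realType) (a b c d M : R) (F : R -> R -> R) :
  c < d ->
  (forall s, a <= s <= b -> bounded_on c d M (F s)) ->
  (forall s, a <= s <= b -> midconvex_on c d (F s)) ->
  (forall t, c <= t <= d -> midconvex_on a b (F ^~ t)) ->
  let G s := \int[lebesgue_measure]_(t in `[c, d]) F s t in
  bounded_on a b (M * (d - c)) G /\ midconvex_on a b G.
Proof.
move=> cd FM Ft Fs G.
have Gi s : a <= s <= b -> lebesgue_measure.-integrable `[c, d]%classic (EFin \o F s).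
  by move=> sab; apply: midconvex_integrable (FM s sab) (Ft s sab).
split=> [s sab|s s' sab s'ab].
  have /andP[_ HH] := hermite_hadamard cd (FM s sab) (Ft s sab).
  apply/andP; split.
    by apply: Rintegral_ge0 => t /=; rewrite in_itv/= => /(FM s sab) /andP[].
  apply: (le_trans HH); rewrite ler_pM2r ?subr_gt0//.
  have /andP[_ Fc] := FM s sab c ltac:(lra).
  have /andP[_ Fd] := FM s sab d ltac:(lra).
  lra.
rewrite -RintegralD ?Gi// -RintegralZr//.
  apply: le_Rintegral => //.
  - by apply: Gi; lra.
  - by apply: integrable_EFinZr => //; apply: integrable_EFinD; rewrite ?Gi.
  by move=> t /=; rewrite in_itv/= => tcd; exact: Fs.
by apply: integrable_EFinD; rewrite ?Gi.
Qed.

Lemma hermite_hadamard_square (R : realType) (M : R) (F : R -> R -> R) :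
  (forall s, 0 <= s <= 1 -> bounded_on 0 1 M (F s)) ->
  (forall s, 0 <= s <= 1 -> midconvex_on 0 1 (F s)) ->
  (forall t, 0 <= t <= 1 -> midconvex_on 0 1 (F ^~ t)) ->
  (forall s t, F (1 - s) (1 - t) = F s t) ->
  forall a b, 0 <= a < 1 / 2 -> 0 <= b < 1 / 2 ->
  [/\ 2 * F (1 / 2) (1 / 2) <=
      1 / (1 - 2 * a) * (\int[lebesgue_measure]_(s in `[a, 1 - a]) F s (1 / 2)) +
      1 / (1 - 2 * b) * (\int[lebesgue_measure]_(t in `[b, 1 - b]) F (1 / 2) t),
      1 / (1 - 2 * a) * (\int[lebesgue_measure]_(s in `[a, 1 - a]) F s (1 / 2)) +
      1 / (1 - 2 * b) * (\int[lebesgue_measure]_(t in `[b, 1 - b]) F (1 / 2) t) <=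
      2 / ((1 - 2 * a) * (1 - 2 * b)) *
      (\int[lebesgue_measure]_(s in `[a, 1 - a])
         \int[lebesgue_measure]_(t in `[b, 1 - b]) F s t)
    & 2 / ((1 - 2 * a) * (1 - 2 * b)) *
      (\int[lebesgue_measure]_(s in `[a, 1 - a])
         \int[lebesgue_measure]_(t in `[b, 1 - b]) F s t) <=
      F a b + F (1 - a) b].
Proof.
move=> FM Ft Fs Fsym a b a01 b01.
have aa : a < 1 - a by lra.
have bb : b < 1 - b by lra.
have FMt s : 0 <= s <= 1 -> bounded_on b (1 - b) M (F s).
  by move=> s01 t tb; apply: FM => //; lra.
have FMs t : 0 <= t <= 1 -> bounded_on a (1 - a) M (F ^~ t).
  by move=> t01 s sa; apply: FM => //; lra.
have Ft' s : 0 <= s <= 1 -> midconvex_on b (1 - b) (F s).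
  by move=> s01 t t' tb tb'; apply: Ft => //; lra.
have Fs' t : 0 <= t <= 1 -> midconvex_on a (1 - a) (F ^~ t).
  by move=> t01 s s' sa sa'; apply: Fs => //; lra.
pose I s := \int[lebesgue_measure]_(t in `[b, 1 - b]) F s t.
have [GM Gmid] : bounded_on a (1 - a) (M * ((1 - b) - b)) I /\ midconvex_on a (1 - a) I.
  apply: Rintegral_midconvex => // [s sa|s sa|t tb]; [apply: FMt|apply: Ft'|apply: Fs']; lra.
have hht s : 0 <= s <= 1 -> F s (1 / 2) * (1 - 2 * b) <= I s
    <= (F s b + F s (1 - b)) / 2 * (1 - 2 * b).
  move=> s01; have := hermite_hadamard bb (FMt s s01) (Ft' s s01).
  have -> : (b + (1 - b)) / 2 = 1 / 2 by lra.
  by have -> : 1 - b - b = 1 - 2 * b by lra.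
have mid : (a + (1 - a)) / 2 = 1 / 2 by lra.
have la : 1 - a - a = 1 - 2 * a by lra.
have hhs t : 0 <= t <= 1 -> F (1 / 2) t * (1 - 2 * a)
    <= \int[lebesgue_measure]_(s in `[a, 1 - a]) F s t
    <= (F a t + F (1 - a) t) / 2 * (1 - 2 * a).
  by move=> t01; have := hermite_hadamard aa (FMs t t01) (Fs' t t01); rewrite mid la.
have iS t : 0 <= t <= 1 -> lebesgue_measure.-integrable `[a, 1 - a]%classic (EFin \o (F ^~ t)).
  by move=> t01; apply: midconvex_integrable (FMs t t01) (Fs' t t01).
have iI := midconvex_integrable GM Gmid.
have pa : 0 < 1 - 2 * a by lra.
have pb : 0 < 1 - 2 * b by lra.
rewrite -/I; set J := \int[lebesgue_measure]_(s in `[a, 1 - a]) (\int[lebesgue_measure]_(t in _) F s t).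
have h12 : 0 <= (1 / 2 : R) <= 1 by lra.
split.
- have /andP[h1 _] := hhs _ h12; have /andP[h2 _] := hht _ h12.
  have e (u v : R) : 1 / u * v = v / u by rewrite mul1r mulrC.
  rewrite -/(I (1 / 2)) !e.
  have : F (1 / 2) (1 / 2) <= (\int[lebesgue_measure]_(s in `[a, 1 - a]) F s (1 / 2)) / (1 - 2 * a).
    by rewrite ler_pdivlMr.
  have : F (1 / 2) (1 / 2) <= I (1 / 2) / (1 - 2 * b) by rewrite ler_pdivlMr.
  lra.
(* The midpoint inequality for [I] gives the second summand, without any
   exchange of the order of integration. *)
- have h1 : I (1 / 2) * (1 - 2 * a) <= J.
    by have /andP[+ _] := hermite_hadamard aa GM Gmid; rewrite mid la.
  have h2 : (\int[lebesgue_measure]_(s in `[a, 1 - a]) F s (1 / 2)) * (1 - 2 * b) <= J.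
    rewrite -RintegralZr ?iS//; apply: le_Rintegral => //.
      by apply: integrable_EFinZr; rewrite ?iS.
    by move=> s /=; rewrite in_itv/= => sa; have /andP[] // := hht s ltac:(lra).
  rewrite -/(I (1 / 2)) -ler_pdivlMr// in h1 h2 *.
  rewrite -ler_pdivlMr// in h2.
  have -> : 2 / ((1 - 2 * a) * (1 - 2 * b)) * J =
     1 / (1 - 2 * a) * (J / (1 - 2 * b)) + 1 / (1 - 2 * b) * (J / (1 - 2 * a)).
    by field; rewrite !gt_eqF.
  by rewrite lerD// ler_wpM2l// divr_ge0// ltW.
- have h12' : forall s, a <= s <= 1 - a -> I s <= (F s b + F s (1 - b)) / 2 * (1 - 2 * b).
    by move=> s sa; have /andP[] // := hht s ltac:(lra).
  have b1 : 0 <= b <= 1 by lra.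
  have b1' : 0 <= 1 - b <= 1 by lra.
  have iSum : lebesgue_measure.-integrable `[a, 1 - a]%classic (EFin \o (fun s => F s b + F s (1 - b))).
    by apply: integrable_EFinD; rewrite ?iS.
  have : J <= \int[lebesgue_measure]_(s in `[a, 1 - a]) ((F s b + F s (1 - b)) * ((1 - 2 * b) / 2)).
    apply: le_Rintegral => //.
      exact: integrable_EFinZr.
    move=> s /=; rewrite in_itv/= => sa; apply: le_trans (h12' s sa) _.
    by rewrite mulrA mulrAC.
  rewrite RintegralZr// RintegralD ?iS// => hJ.
  have /andP[_ u1] := hhs b b1; have /andP[_ u2] := hhs (1 - b) b1'.
  have e1 : F a (1 - b) = F (1 - a) b by rewrite -Fsym subKr.
  have e2 : F (1 - a) (1 - b) = F a b by rewrite Fsym.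
  rewrite e1 e2 in u2.
  have {}hJ : J <= (F a b + F (1 - a) b) / 2 * ((1 - 2 * a) * (1 - 2 * b)).
    apply: (le_trans hJ).
    have -> : (F a b + F (1 - a) b) / 2 * ((1 - 2 * a) * (1 - 2 * b)) =
      ((F a b + F (1 - a) b) * (1 - 2 * a)) * ((1 - 2 * b) / 2) by field.
    rewrite ler_pM2r ?divr_gt0//; lra.
  rewrite -ler_pdivrMr ?mulr_gt0// in hJ.
  have -> : 2 / ((1 - 2 * a) * (1 - 2 * b)) * J = 2 * (J / ((1 - 2 * a) * (1 - 2 * b))) by rewrite mulrAC mulrA.
  lra.
Qed.

(** A product of midpoint log-convex functions is midpoint log-convex, hence
    midpoint convex by the arithmetic-geometric mean inequality. *)
Lemma mul_midconvex (R : realType) (f g : R -> R) (c d : R) :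
  (forall x, 0 <= f x) -> (forall x, 0 <= g x) ->
  (forall x y, c <= x <= d -> c <= y <= d -> f ((x + y) / 2) ^+ 2 <= f x * f y) ->
  (forall x y, c <= x <= d -> c <= y <= d -> g ((x + y) / 2) ^+ 2 <= g x * g y) ->
  midconvex_on c d (fun x => f x * g x).
Proof.
move=> f0 g0 fm gm x y xcd ycd.
have := ler_pM (sqr_ge0 _) (sqr_ge0 _) (fm x y xcd ycd) (gm x y xcd ycd).
rewrite -exprMn mulrACA => le2.
have fg0 z : 0 <= f z * g z by rewrite mulr_ge0.
rewrite -(ler_sqr _ _) ?nnegrE ?divr_ge0 ?addr_ge0//; apply: le_trans le2 _.
rewrite -subr_ge0.
have -> : ((f x * g x + f y * g y) / 2) ^+ 2 - f x * g x * (f y * g y) =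
  ((f x * g x - f y * g y) / 2) ^+ 2 by field.
exact: sqr_ge0.
Qed.

Lemma log_midconvex_hermite_hadamard (R : realType) (K : R) (phi : R -> R -> R) :
  (forall s u, 0 <= phi s u) ->
  (forall s u, 0 <= s <= 1 -> 0 <= u <= 1 -> phi s u <= K) ->
  (forall s s' u, 0 <= s <= 1 -> 0 <= s' <= 1 -> 0 <= u <= 1 ->
    phi ((s + s') / 2) u ^+ 2 <= phi s u * phi s' u) ->
  (forall s u u', 0 <= s <= 1 -> 0 <= u <= 1 -> 0 <= u' <= 1 ->
    phi s ((u + u') / 2) ^+ 2 <= phi s u * phi s u') ->
  (forall a b : R, 0 <= a < 1 / 2 -> 0 <= b < 1 / 2 ->
    [/\ 2 * phi (1 / 2) (1 / 2) ^+ 2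
        <= 1 / (1 - 2 * a) *
             (\int[lebesgue_measure]_(s in `[a, 1 - a])
               (phi s (1 / 2)
                * phi (1 - s) (1 / 2)))
           + 1 / (1 - 2 * b) *
             (\int[lebesgue_measure]_(t in `[b, 1 - b])
               (phi (1 / 2) (1 - t)
                * phi (1 / 2) t)),
        1 / (1 - 2 * a) *
             (\int[lebesgue_measure]_(s in `[a, 1 - a])
               (phi s (1 / 2)
                * phi (1 - s) (1 / 2)))
           + 1 / (1 - 2 * b) *
             (\int[lebesgue_measure]_(t in `[b, 1 - b])
               (phi (1 / 2) (1 - t)
                * phi (1 / 2) t))
        <= 2 / ((1 - 2 * a) * (1 - 2 * b)) *
             (\int[lebesgue_measure]_(s in `[a, 1 - a]) \int[lebesgue_measure]_(t in `[b, 1 - b])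
               (phi s (1 - t)
                * phi (1 - s) t))
      & 2 / ((1 - 2 * a) * (1 - 2 * b)) *
             (\int[lebesgue_measure]_(s in `[a, 1 - a]) \int[lebesgue_measure]_(t in `[b, 1 - b])
               (phi s (1 - t)
                * phi (1 - s) t))
        <= phi a (1 - b)
             * phi (1 - a) b
           + phi (1 - a) (1 - b)
             * phi a b])
  /\
  (forall a b : R, 1 / 2 < a <= 1 -> 1 / 2 < b <= 1 ->
    [/\ 2 * phi (1 / 2) (1 / 2) ^+ 2
        <= 1 / (2 * a - 1) *
             (\int[lebesgue_measure]_(s in `[1 - a, a])
               (phi s (1 / 2)
                * phi (1 - s) (1 / 2)))
           + 1 / (2 * b - 1) *
             (\int[lebesgue_measure]_(t in `[1 - b, b])
               (phi (1 / 2) (1 - t)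
                * phi (1 / 2) t)),
        1 / (2 * a - 1) *
             (\int[lebesgue_measure]_(s in `[1 - a, a])
               (phi s (1 / 2)
                * phi (1 - s) (1 / 2)))
           + 1 / (2 * b - 1) *
             (\int[lebesgue_measure]_(t in `[1 - b, b])
               (phi (1 / 2) (1 - t)
                * phi (1 / 2) t))
        <= 2 / ((2 * a - 1) * (2 * b - 1)) *
             (\int[lebesgue_measure]_(s in `[1 - a, a]) \int[lebesgue_measure]_(t in `[1 - b, b])
               (phi s (1 - t)
                * phi (1 - s) t))
      & 2 / ((2 * a - 1) * (2 * b - 1)) *
             (\int[lebesgue_measure]_(s in `[1 - a, a]) \int[lebesgue_measure]_(t in `[1 - b, b])
               (phi s (1 - t)
                * phi (1 - s) t))
        <= phi a (1 - b)
             * phi (1 - a) b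
           + phi (1 - a) (1 - b)
             * phi a b]).
Proof.
move=> phi0 phiK phis phiu.
pose F s t := phi s (1 - t) * phi (1 - s) t.
have FM s : 0 <= s <= 1 -> bounded_on 0 1 (K * K) (F s).
  move=> s01 t t01; rewrite /F mulr_ge0//= ler_pM// phiK//; lra.
have mid1 (x y : R) : 1 - (x + y) / 2 = ((1 - x) + (1 - y)) / 2 by field.
have Ft s : 0 <= s <= 1 -> midconvex_on 0 1 (F s).
  move=> s01; apply: mul_midconvex => // x y x01 y01; last by apply: phiu; lra.
  by rewrite mid1; apply: phiu; lra.
have Fs t : 0 <= t <= 1 -> midconvex_on 0 1 (F ^~ t).
  move=> t01; apply: mul_midconvex => // x y x01 y01; first by apply: phis; lra.
  by rewrite mid1; apply: phis; lra.
have Fsym s t : F (1 - s) (1 - t) = F s t by rewrite /F !subKr mulrC.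
have hh := hermite_hadamard_square FM Ft Fs Fsym.
have half : 1 - 1 / 2 = 1 / 2 :> R by lra.
split=> a b ha hb.
  have := hh a b ha hb.
  by rewrite /F half -expr2 subKr.
have := hh (1 - a) (1 - b).
rewrite /F half -expr2 !subKr.
have -> : 1 - 2 * (1 - a) = 2 * a - 1 by lra.
have -> : 1 - 2 * (1 - b) = 2 * b - 1 by lra.
rewrite (mulrC (phi (1 - a) b)) (mulrC (phi a b)); apply; lra.
Qed.

Theorem corollary2p5 (R : realType) (n : nat) (A B X : 'M[R[i]]_n) (r : R)
    (N : 'M[R[i]]_n -> R)
    (hA : psdmx A) (hB : psdmx B) (hr : 0 <= r)
    (hN : is_mxnorm N) (hUI : unitarily_invariant N) :
  (forall a b : R, 0 <= a < 1 / 2 -> 0 <= b < 1 / 2 ->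
    [/\ 2 * normabs N r (A `^mx (1 / 2) *m X *m B `^mx (1 / 2)) ^+ 2
        <= 1 / (1 - 2 * a) *
             (\int[lebesgue_measure]_(s in `[a, 1 - a])
               (normabs N r (A `^mx s *m X *m B `^mx (1 / 2))
                * normabs N r (A `^mx (1 - s) *m X *m B `^mx (1 / 2))))
           + 1 / (1 - 2 * b) *
             (\int[lebesgue_measure]_(t in `[b, 1 - b])
               (normabs N r (A `^mx (1 / 2) *m X *m B `^mx (1 - t))
                * normabs N r (A `^mx (1 / 2) *m X *m B `^mx t))),
        1 / (1 - 2 * a) *
             (\int[lebesgue_measure]_(s in `[a, 1 - a])
               (normabs N r (A `^mx s *m X *m B `^mx (1 / 2))
                * normabs N r (A `^mx (1 - s) *m X *m B `^mx (1 / 2))))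
           + 1 / (1 - 2 * b) *
             (\int[lebesgue_measure]_(t in `[b, 1 - b])
               (normabs N r (A `^mx (1 / 2) *m X *m B `^mx (1 - t))
                * normabs N r (A `^mx (1 / 2) *m X *m B `^mx t)))
        <= 2 / ((1 - 2 * a) * (1 - 2 * b)) *
             (\int[lebesgue_measure]_(s in `[a, 1 - a]) \int[lebesgue_measure]_(t in `[b, 1 - b])
               (normabs N r (A `^mx s *m X *m B `^mx (1 - t))
                * normabs N r (A `^mx (1 - s) *m X *m B `^mx t)))
      & 2 / ((1 - 2 * a) * (1 - 2 * b)) *
             (\int[lebesgue_measure]_(s in `[a, 1 - a]) \int[lebesgue_measure]_(t in `[b, 1 - b])
               (normabs N r (A `^mx s *m X *m B `^mx (1 - t))
                * normabs N r (A `^mx (1 - s) *m X *m B `^mx t)))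
        <= normabs N r (A `^mx a *m X *m B `^mx (1 - b))
             * normabs N r (A `^mx (1 - a) *m X *m B `^mx b)
           + normabs N r (A `^mx (1 - a) *m X *m B `^mx (1 - b))
             * normabs N r (A `^mx a *m X *m B `^mx b)])
  /\
  (forall a b : R, 1 / 2 < a <= 1 -> 1 / 2 < b <= 1 ->
    [/\ 2 * normabs N r (A `^mx (1 / 2) *m X *m B `^mx (1 / 2)) ^+ 2
        <= 1 / (2 * a - 1) *
             (\int[lebesgue_measure]_(s in `[1 - a, a])
               (normabs N r (A `^mx s *m X *m B `^mx (1 / 2))
                * normabs N r (A `^mx (1 - s) *m X *m B `^mx (1 / 2))))
           + 1 / (2 * b - 1) *
             (\int[lebesgue_measure]_(t in `[1 - b, b])
               (normabs N r (A `^mx (1 / 2) *m X *m B `^mx (1 - t))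
                * normabs N r (A `^mx (1 / 2) *m X *m B `^mx t))),
        1 / (2 * a - 1) *
             (\int[lebesgue_measure]_(s in `[1 - a, a])
               (normabs N r (A `^mx s *m X *m B `^mx (1 / 2))
                * normabs N r (A `^mx (1 - s) *m X *m B `^mx (1 / 2))))
           + 1 / (2 * b - 1) *
             (\int[lebesgue_measure]_(t in `[1 - b, b])
               (normabs N r (A `^mx (1 / 2) *m X *m B `^mx (1 - t))
                * normabs N r (A `^mx (1 / 2) *m X *m B `^mx t)))
        <= 2 / ((2 * a - 1) * (2 * b - 1)) *
             (\int[lebesgue_measure]_(s in `[1 - a, a]) \int[lebesgue_measure]_(t in `[1 - b, b])
               (normabs N r (A `^mx s *m X *m B `^mx (1 - t))
                * normabs N r (A `^mx (1 - s) *m X *m B `^mx t)))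
      & 2 / ((2 * a - 1) * (2 * b - 1)) *
             (\int[lebesgue_measure]_(s in `[1 - a, a]) \int[lebesgue_measure]_(t in `[1 - b, b])
               (normabs N r (A `^mx s *m X *m B `^mx (1 - t))
                * normabs N r (A `^mx (1 - s) *m X *m B `^mx t)))
        <= normabs N r (A `^mx a *m X *m B `^mx (1 - b))
             * normabs N r (A `^mx (1 - a) *m X *m B `^mx b)
           + normabs N r (A `^mx (1 - a) *m X *m B `^mx (1 - b))
             * normabs N r (A `^mx a *m X *m B `^mx b)]).
Proof.
have [K phiK] := normabs_mxpow2_bounded X hN hUI hr hA hB.
apply: (@log_midconvex_hermite_hadamard R K
  (fun s u => normabs N r (A `^mx s *m X *m B `^mx u))) => [s u|||].
- by case: hN => + _ _ _; apply.
- exact: phiK.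
- move=> s s' u /andP[s0 _] /andP[s0' _] _.
  exact: (normabs_mxpowl_midpoint X (B `^mx u) hN hUI hr hA s0 s0').
- move=> s u u' _ /andP[u0 _] /andP[u0' _].
  exact: (normabs_mxpowr_midpoint (A `^mx s *m X) hN hUI hr hB u0 u0').
Qed.
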